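(* Fix $n \geq 0$. Every $\emptyset^{(n+1)}$-computable set $A \subseteq \omega$ has an infinite subset $H$ with $H \subseteq A$ or $H \subseteq \omega\setminus A$ such that $H$ is low${}_{n+2}$, i.e. $H^{(n+2)} \leq_T \emptyset^{(n+2)}$.
   Context: $X^{(k)}$ denotes the $k$-th Turing jump of $X$. *)

(* Defs.v *)
From HB Require Import structures.
From mathcomp Require Import all_boot.
From Stdlib Require Import ClassicalEpsilon.
Set Implicit Arguments. Unset Strict Implicit. Unset Printing Implicit Defensive.

Inductive prf : Type :=
| PZero
| PSucc
| PProj of nat
| POracle
| PComp of prf & seq prf
| PRec of prf & prf
| PMu of prf.

Inductive eval (X : nat -> bool) : prf -> seq nat -> nat -> Prop :=
| ev_zero v : eval X PZero v 0
| ev_succ x v : eval X PSucc (x :: v) x.+1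
| ev_proj i v : eval X (PProj i) v (nth 0 v i)
| ev_oracle x v : eval X POracle (x :: v) (if X x then 1 else 0)
| ev_comp f gs v ws y :
    evals X gs v ws -> eval X f ws y -> eval X (PComp f gs) v y
| ev_rec0 f g v y : eval X f v y -> eval X (PRec f g) (0 :: v) y
| ev_recS f g n v z y :
    eval X (PRec f g) (n :: v) z -> eval X g (n :: z :: v) y ->
    eval X (PRec f g) (n.+1 :: v) y
| ev_mu f v n :
    eval X f (n :: v) 0 ->
    (forall m, m < n -> exists k, eval X f (m :: v) k.+1) ->
    eval X (PMu f) v n
with evals (X : nat -> bool) : seq prf -> seq nat -> seq nat -> Prop :=
| evs_nil v : evals X [::] v [::]
| evs_cons g gs v y ys :
    eval X g v y -> evals X gs v ys -> evals X (g :: gs) v (y :: ys).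

Fixpoint prf_enc (p : prf) : GenTree.tree nat :=
  match p with
  | PZero => GenTree.Node 0 [::]
  | PSucc => GenTree.Node 1 [::]
  | PProj i => GenTree.Node 2 [:: GenTree.Leaf i]
  | POracle => GenTree.Node 3 [::]
  | PComp f gs => GenTree.Node 4 (prf_enc f :: map prf_enc gs)
  | PRec f g => GenTree.Node 5 [:: prf_enc f; prf_enc g]
  | PMu f => GenTree.Node 6 [:: prf_enc f]
  end.

Fixpoint prf_dec (t : GenTree.tree nat) : option prf :=
  let fix decs (ts : seq (GenTree.tree nat)) : option (seq prf) :=
    match ts with
    | [::] => Some [::]
    | t :: ts => match prf_dec t, decs ts with
                 | Some p, Some ps => Some (p :: ps)
                 | _, _ => None
                 end
    end in
  match t with
  | GenTree.Node 0 [::] => Some PZero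
  | GenTree.Node 1 [::] => Some PSucc
  | GenTree.Node 2 [:: GenTree.Leaf i] => Some (PProj i)
  | GenTree.Node 3 [::] => Some POracle
  | GenTree.Node 4 (tf :: tgs) =>
      match prf_dec tf, decs tgs with
      | Some f, Some gs => Some (PComp f gs)
      | _, _ => None
      end
  | GenTree.Node 5 [:: tf; tg] =>
      match prf_dec tf, prf_dec tg with
      | Some f, Some g => Some (PRec f g)
      | _, _ => None
      end
  | GenTree.Node 6 [:: tf] =>
      match prf_dec tf with Some f => Some (PMu f) | None => None end
  | _ => None
  end.

Fixpoint prf_encK (p : prf) : prf_dec (prf_enc p) = Some p :=
  match p return prf_dec (prf_enc p) = Some p with
  | PZero => erefl | PSucc => erefl | PProj i => erefl | POracle => erefl
  | PComp f gs =>
      let fix aux (gs : seq prf) :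
        (fix decs (ts : seq (GenTree.tree nat)) : option (seq prf) :=
          match ts with
          | [::] => Some [::]
          | t :: ts => match prf_dec t, decs ts with
                       | Some p, Some ps => Some (p :: ps)
                       | _, _ => None
                       end
          end) (map prf_enc gs) = Some gs :=
        match gs with
        | [::] => erefl
        | g :: gs' => ltac:(simpl; rewrite (prf_encK g) (aux gs'); reflexivity)
        end in
      ltac:(simpl; rewrite (prf_encK f) (aux gs); reflexivity)
  | PRec f g => ltac:(simpl; rewrite (prf_encK f) (prf_encK g); reflexivity)
  | PMu f => ltac:(simpl; rewrite (prf_encK f); reflexivity)
  end.

HB.instance Definition _ := Countable.copy prf (pcan_type prf_encK).

(* The e-th program: programs are numbered by the countable encoding;
   numbers that decode to nothing are assigned the (nowhere-halting)
   program PMu PSucc. *)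
Definition program (e : nat) : prf := odflt (PMu PSucc) (unpickle e).

Definition emptyset : nat -> bool := fun _ => false.

Definition computable_in (X A : nat -> bool) : Prop :=
  exists p : prf, forall x, eval X p [:: x] (if A x then 1 else 0).

Definition Tle (A X : nat -> bool) : Prop := computable_in X A.

Definition asbool (P : Prop) : bool :=
  if excluded_middle_informative P then true else false.

Definition jump (X : nat -> bool) : nat -> bool :=
  fun e => asbool (exists y, eval X (program e) [:: e] y).

Definition jumpn (k : nat) (X : nat -> bool) : nat -> bool := iter k jump X.

Definition infinite_set (H : nat -> bool) : Prop :=
  forall m, exists x, m <= x /\ H x.

(* Main.v *)
(** Write [ext Y s t] when the string [t] extends [s] by elements of [Y] only. By
    induction on [k] we build an oracle [L_k] above [0^(k)] with [L_k' <= 0^(k+1)],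
    a relation [R_k j s u] enumerable in [L_k], meaning that the string [s] with
    reservoir [X_u] forces [j] into (a set equivalent to) [G^(k+1)], and a
    decreasing sequence of reservoirs. A requirement [(s, j)] holds of a set [Y]
    when some [t] with [ext Y s t] forces [j]; this is an open, upward closed
    property of [Y].

    To pass from [k] to [k+1], handle every finite tuple of requirements
    [e_0, ..., e_(r-1)] infinitely often: if the current reservoir is covered by
    sets [Y_0, ..., Y_(r-1)] such that [e_i] fails of [Y_i], replace it by one of
    them, and otherwise every cover of it satisfies some [e_i]. All possible
    choices of covers form a [Pi_1(L_k)] class, and the choices of pieces that
    keep satisfying the requirements inherited from the previous level form a
    [Pi_1(L_k')] class, nonempty because those requirements define a partition
    regular notion of largeness. Two applications of the low basis theorem yield
    [L_(k+1) >= L_k'] with [L_(k+1)' <= L_k'']. A requirement satisfied by all the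
    resulting reservoirs cannot be refuted later, which makes "some reservoir
    fails [(s, i)]" an adequate, [L_(k+1)]-enumerable, way of forcing [i] out of
    [G^(k+1)], and thus defines [R_(k+1)].

    At level [n] the tuples of length two, applied to the cover of a reservoir by
    [A] and its complement, let [L_(n+1)] build [G_1] inside [A] and [G_0] inside
    the complement so that for each pair of requirements one of the two sides is
    decided. Hence one side decides everything, and its set [G] satisfies
    [G^(n+1) <= L_(n+1)], so [G^(n+2) <= L_(n+1)' <= 0^(n+2)]. *)

Require Import Defs.
From mathcomp Require Import all_boot zify.
From Stdlib Require Import Classical ClassicalEpsilon.
Set Implicit Arguments. Unset Strict Implicit. Unset Printing Implicit Defensive.

(** * Oracle-uniform computability *)

Definition rawcomp n (f : seq nat -> nat) :=
  exists p, forall X v, size v = n -> eval X p v (f v).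

Lemma rawcomp_ext n f g :
  (forall v, size v = n -> f v = g v) -> rawcomp n f -> rawcomp n g.
Proof. by move=> e [p Hp]; exists p => X v sv; rewrite -e //; apply: Hp. Qed.

Lemma rawcomp_nth n i : rawcomp n (fun v => nth 0 v i).
Proof. by exists (PProj i) => X v _; constructor. Qed.

Lemma rawcomp_comp1 n f g :
  rawcomp 1 f -> rawcomp n g -> rawcomp n (fun v => f [:: g v]).
Proof.
move=> [p Hp] [q Hq]; exists (PComp p [:: q]) => X v sv.
by econstructor; [econstructor; [exact: Hq|constructor]|exact: Hp].
Qed.

Lemma rawcomp_comp2 n f g h :
  rawcomp 2 f -> rawcomp n g -> rawcomp n h ->
  rawcomp n (fun v => f [:: g v; h v]).
Proof.
move=> [p Hp] [q Hq] [r Hr]; exists (PComp p [:: q; r]) => X v sv.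
econstructor; last exact: Hp.
by econstructor; [exact: Hq|econstructor; [exact: Hr|constructor]].
Qed.

Lemma rawcomp_comp3 n f g h k :
  rawcomp 3 f -> rawcomp n g -> rawcomp n h -> rawcomp n k ->
  rawcomp n (fun v => f [:: g v; h v; k v]).
Proof.
move=> [p Hp] [q Hq] [r Hr] [u Hu]; exists (PComp p [:: q; r; u]) => X v sv.
econstructor; last exact: Hp.
econstructor; [exact: Hq|econstructor; [exact: Hr|]].
by econstructor; [exact: Hu|constructor].
Qed.

Lemma rawcomp_succ n f : rawcomp n f -> rawcomp n (fun v => (f v).+1).
Proof.
move=> [p Hp]; exists (PComp PSucc [:: p]) => X v sv.
by econstructor; [econstructor; [exact: Hp|constructor]|constructor].
Qed.

Lemma rawcomp_const n c : rawcomp n (fun=> c).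
Proof.
elim: c => [|c IH]; first by exists PZero => X v _; constructor.
exact: rawcomp_succ.
Qed.

(** [PRec] takes its recursion argument at the head of the list, so the remaining arguments have to
    be copied behind it by projections. *)
Lemma evals_proj X (v w : seq nat) k :
  v = drop k w -> evals X [seq PProj i | i <- iota k (size v)] w v.
Proof.
elim: v k => [|x v IH] k e /=; first by constructor.
have sk: k < size w by move: (congr1 size e); rewrite size_drop /=; lia.
have [ex ev] : nth 0 w k = x /\ drop k.+1 w = v.
  by move: e; rewrite (drop_nth 0) // => -[-> ->].
by constructor; [rewrite -ex; constructor|apply: IH].
Qed.

Lemma rawcomp_rec n m f g :
  rawcomp n m -> rawcomp n f -> rawcomp n.+2 g ->
  rawcomp n (fun v => nat_rec _ (f v) (fun k z => g [:: k, z & v]) (m v)).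
Proof.
move=> [p Hp] [q Hq] [r Hr].
exists (PComp (PRec q r) (p :: [seq PProj i | i <- iota 0 n])) => X v sv.
apply: (@ev_comp _ _ _ _ (m v :: v)).
  by constructor; [exact: Hp|rewrite -sv; apply: evals_proj; rewrite drop0].
elim: (m v) => [|k IH] /=; first by constructor; exact: Hq.
by econstructor; [exact: IH|apply: Hr; rewrite /= sv].
Qed.

Lemma rawcomp_mu n f h :
  rawcomp n.+1 f ->
  (forall v, size v = n -> f (h v :: v) = 0) ->
  (forall v m, size v = n -> m < h v -> 0 < f (m :: v)) ->
  rawcomp n h.
Proof.
move=> [p Hp] h0 hm; exists (PMu p) => X v sv; constructor.
  by rewrite -(h0 v sv); apply: Hp; rewrite /= sv.
move=> m lm; exists (f (m :: v)).-1; rewrite prednK ?hm //.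
by apply: Hp; rewrite /= sv.
Qed.

Lemma rawcomp_add n f g :
  rawcomp n f -> rawcomp n g -> rawcomp n (fun v => f v + g v).
Proof.
move=> Hf Hg.
apply: rawcomp_ext (rawcomp_rec Hg Hf (rawcomp_succ (rawcomp_nth _ 1))) => v _ /=.
by elim: (g v) => [|k IH] /=; rewrite ?addn0 ?addnS ?IH.
Qed.

Lemma rawcomp_mul n f g :
  rawcomp n f -> rawcomp n g -> rawcomp n (fun v => f v * g v).
Proof.
move=> Hf Hg.
have H2: rawcomp 2 (fun v => nth 0 v 0 * nth 0 v 1).
  apply: rawcomp_ext (rawcomp_rec (rawcomp_nth 2 1) (rawcomp_const 2 0)
    (rawcomp_add (rawcomp_nth 4 1) (rawcomp_nth 4 2))) => v _ /=.
  by elim: (nth 0 v 1) => [|k IH] /=; rewrite ?muln0 ?mulnS ?IH // addnC.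
exact: (rawcomp_comp2 H2 Hf Hg).
Qed.

Lemma rawcomp_pred n f : rawcomp n f -> rawcomp n (fun v => (f v).-1).
Proof.
move=> Hf.
apply: rawcomp_ext (rawcomp_rec Hf (rawcomp_const n 0) (rawcomp_nth n.+2 0)) => v _.
by case: (f v).
Qed.

Lemma rawcomp_sub n f g :
  rawcomp n f -> rawcomp n g -> rawcomp n (fun v => f v - g v).
Proof.
move=> Hf Hg.
apply: rawcomp_ext (rawcomp_rec Hg Hf (rawcomp_pred (rawcomp_nth _ 1))) => v _ /=.
by elim: (g v) => [|k IH] /=; rewrite ?subn0 ?subnS ?IH.
Qed.

Lemma rawcomp_exp2 n f : rawcomp n f -> rawcomp n (fun v => 2 ^ f v).
Proof.
move=> Hf.
apply: rawcomp_ext (rawcomp_rec Hf (rawcomp_const n 1)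
  (rawcomp_mul (rawcomp_const _ 2) (rawcomp_nth n.+2 1))) => v _ /=.
by elim: (f v) => [|k IH] //=; rewrite expnS IH.
Qed.

Lemma rawcomp_if n c f g :
  rawcomp n c -> rawcomp n f -> rawcomp n g ->
  rawcomp n (fun v => if c v is 0 then g v else f v).
Proof.
move=> Hc Hf Hg.
have H3: rawcomp 3 (fun v => if nth 0 v 0 is 0 then nth 0 v 2 else nth 0 v 1).
  apply: rawcomp_ext (rawcomp_rec (rawcomp_nth 3 0) (rawcomp_nth 3 2)
    (rawcomp_nth 5 3)) => v _ /=.
  by case: (nth 0 v 0).
exact: (rawcomp_comp3 H3 Hc Hf Hg).
Qed.

(* The pairing underlying [CodeSeq.code], shifted to become a bijection. *)
Definition npair x y := (2 ^ x * y.*2.+1).-1.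

Lemma npairS x y : (npair x y).+1 = 2 ^ x * y.*2.+1.
Proof. by rewrite prednK // muln_gt0 expn_gt0. Qed.

Lemma npair_code x l : CodeSeq.code (x :: l) = (npair x (CodeSeq.code l)).+1.
Proof. by rewrite npairS. Qed.

Lemma npair_inj x y x' y' : npair x y = npair x' y' -> x = x' /\ y = y'.
Proof.
move=> e; have := congr1 S e; rewrite !npairS.
rewrite -[y]CodeSeq.decodeK -[y']CodeSeq.decodeK => {e}.
move=> /(congr1 CodeSeq.decode).
rewrite -[_ ^ _ * _]/(CodeSeq.code (x :: CodeSeq.decode y)).
rewrite -[_ ^ _ * _]/(CodeSeq.code (x' :: CodeSeq.decode y')) !CodeSeq.codeK.
by case=> -> ->.
Qed.

Definition nfst z := head 0 (CodeSeq.decode z.+1).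
Definition nsnd z := CodeSeq.code (behead (CodeSeq.decode z.+1)).

Lemma npairK z : npair (nfst z) (nsnd z) = z.
Proof.
apply: succn_inj; rewrite -npair_code.
rewrite /nfst; have := CodeSeq.decodeK z.+1; case: (CodeSeq.decode _) => //= x l.
Qed.

Lemma nfst_pair x y : nfst (npair x y) = x.
Proof. by case: (@npair_inj _ _ _ _ (npairK (npair x y))). Qed.

Lemma nsnd_pair x y : nsnd (npair x y) = y.
Proof. by case: (@npair_inj _ _ _ _ (npairK (npair x y))). Qed.

Lemma leq_npair1 x y : x <= npair x y.
Proof.
rewrite -ltnS npairS; apply: leq_trans (ltn_expl x (ltnSn 1)) _.
by rewrite leq_pmulr.
Qed.

Lemma leq_npair2 x y : y <= npair x y.
Proof.
rewrite -ltnS npairS; apply: (@leq_trans y.*2.+1); first by rewrite ltnS; lia.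
by rewrite leq_pmull // expn_gt0.
Qed.

Lemma rawcomp_npair n f g :
  rawcomp n f -> rawcomp n g -> rawcomp n (fun v => npair (f v) (g v)).
Proof.
move=> Hf Hg; apply: rawcomp_pred; apply: rawcomp_mul; first exact: rawcomp_exp2.
apply: rawcomp_succ; apply: (@rawcomp_ext _ (fun v => g v + g v)).
  by move=> v _; rewrite addnn.
exact: rawcomp_add.
Qed.

Definition neqn x y := (x - y) + (y - x).
Lemma neqn0 x y : (neqn x y == 0) = (x == y).
Proof. rewrite /neqn; lia. Qed.

Lemma rawcomp_neqn n f g :
  rawcomp n f -> rawcomp n g -> rawcomp n (fun v => neqn (f v) (g v)).
Proof. by move=> Hf Hg; apply: rawcomp_add; apply: rawcomp_sub. Qed.

Lemma rawcomp_nfst1 : rawcomp 1 (fun v => nfst (nth 0 v 0)).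
Proof.
(* [s m z] is the product of [neqn (npair m k) z] over [k <= z]. It vanishes exactly when [m] is the
   first component of [z]; the range suffices because [nsnd z <= z]. Minimising over [m] gives
   [nfst]. *)
pose s m z := nat_rec (fun=> nat) 1 (fun k acc => acc * neqn (npair m k) z) z.+1.
have s0 m z : s m z = 0 <-> m = nfst z.
  rewrite /s; split.
    elim: z.+1 => //= k IH /eqP; rewrite muln_eq0 neqn0 => /orP[/eqP/IH//|/eqP <-].
    by rewrite nfst_pair.
  move=> ->; have: nsnd z < z.+1 by rewrite ltnS -{2}(npairK z) leq_npair2.
  elim: z.+1 => //= k IH; rewrite ltnS leq_eqVlt => /predU1P[<-|/IH -> //].
  by apply/eqP; rewrite muln_eq0 neqn0 npairK eqxx orbT.
have Hs : rawcomp 2 (fun v => s (nth 0 v 0) (nth 0 v 1)).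
  apply: rawcomp_ext (rawcomp_rec (rawcomp_succ (rawcomp_nth 2 1))
    (rawcomp_const 2 1) (rawcomp_mul (rawcomp_nth 4 1) (rawcomp_neqn
      (rawcomp_npair (rawcomp_nth 4 2) (rawcomp_nth 4 0)) (rawcomp_nth 4 3)))).
  by move=> v _ /=; rewrite /s.
apply: (rawcomp_mu Hs) => [v _|v m _ lm] /=; first exact/s0.
by rewrite lt0n; apply/eqP => /s0 e; rewrite e ltnn in lm.
Qed.

Lemma rawcomp_nfst n f : rawcomp n f -> rawcomp n (fun v => nfst (f v)).
Proof. exact: (rawcomp_comp1 rawcomp_nfst1). Qed.

Lemma rawcomp_nsnd n f : rawcomp n f -> rawcomp n (fun v => nsnd (f v)).
Proof.
have H1 : rawcomp 1 (fun v => nsnd (nth 0 v 0)); last exact: (rawcomp_comp1 H1).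
apply: (@rawcomp_mu _ (fun v => neqn (npair (nfst (nth 0 v 1)) (nth 0 v 0)) (nth 0 v 1))).
- apply: rawcomp_neqn; last exact: rawcomp_nth.
  by apply: rawcomp_npair; [apply: rawcomp_nfst|]; apply: rawcomp_nth.
- by move=> v _ /=; apply/eqP; rewrite neqn0 npairK.
move=> v m _ /= lm; rewrite lt0n neqn0; apply/eqP => e.
have [_ em] := npair_inj (etrans e (esym (npairK (nth 0 v 0)))).
by rewrite em ltnn in lm.
Qed.

(* [dec] need not be effective: for [prf] it merely chooses a preimage. *)
Class encodable (A : Type) := Encodable {
  enc : A -> nat;
  dec : nat -> A;
  encK : cancel enc dec }.

#[export] Instance nat_enc : encodable nat := @Encodable nat id id (fun=> erefl).

Lemma bool_encK : cancel nat_of_bool (fun n => n != 0).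
Proof. by case. Qed.

#[export] Instance bool_enc : encodable bool := Encodable bool_encK.

#[export] Instance prod_enc (A B : Type) (eA : encodable A) (eB : encodable B) :
  encodable (A * B).
Proof.
apply: (@Encodable _ (fun p => npair (enc p.1) (enc p.2))
  (fun n => (dec (nfst n), dec (nsnd n)))).
by case=> a b; rewrite nfst_pair nsnd_pair !encK.
Defined.

#[export] Instance seq_enc (A : Type) (eA : encodable A) : encodable (seq A).
Proof.
apply: (@Encodable _ (fun l => CodeSeq.code (map enc l))
  (fun n => map dec (CodeSeq.decode n))).
by move=> l; rewrite CodeSeq.codeK (mapK encK).
Defined.

Lemma enc_bool (x : bool) : enc x = x. Proof. by []. Qed.
Lemma enc_cons A (eA : encodable A) (x : A) l : enc (x :: l) = (npair (enc x) (enc l)).+1.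
Proof. by rewrite -npair_code. Qed.
Lemma size_enc A (eA : encodable A) (l : seq A) : size l <= enc l.
Proof.
elim: l => // x l IH; rewrite enc_cons ltnS.
exact: leq_trans IH (leq_npair2 _ _).
Qed.

(** * Closure properties of functions computable uniformly in a family of oracles *)

Section UniformlyComputable.

Variables (I : Type) (O : I -> nat -> bool).

(* A single program must work for all the oracles [O i]. *)
Definition ucomp A B (eA : encodable A) (eB : encodable B) (f : I -> A -> B) :=
  exists p, forall i a, eval (O i) p [:: enc a] (enc (f i a)).

Local Notation C := (@ucomp _ _ _ _).

Section Basic.
Context {A : Type} {eA : encodable A}.

Lemma ucomp_ext {B} {eB : encodable B} (f g : I -> A -> B) :
  (forall i a, f i a = g i a) -> C f -> C g.
Proof. by move=> e [p Hp]; exists p => i a; rewrite -e. Qed.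

Lemma ucomp_raw1 {B D} {eB : encodable B} {eD : encodable D}
    (h : D -> B) k (f : I -> A -> D) :
  rawcomp 1 k -> (forall d, enc (h d) = k [:: enc d]) ->
  C f -> C (fun i a => h (f i a)).
Proof.
move=> [p Hp] e [q Hq]; exists (PComp p [:: q]) => i a; rewrite e.
by econstructor; [econstructor; [exact: Hq|constructor]|exact: Hp].
Qed.

Lemma ucomp_raw2 {B D E} {eB : encodable B} {eD : encodable D} {eE : encodable E}
    (h : D -> E -> B) k (f : I -> A -> D) (g : I -> A -> E) :
  rawcomp 2 k -> (forall d x, enc (h d x) = k [:: enc d; enc x]) ->
  C f -> C g -> C (fun i a => h (f i a) (g i a)).
Proof.
move=> [p Hp] e [q Hq] [r Hr]; exists (PComp p [:: q; r]) => i a; rewrite e.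
econstructor; last exact: Hp.
by econstructor; [exact: Hq|econstructor; [exact: Hr|constructor]].
Qed.

Lemma ucomp_id : C (fun i (a : A) => a).
Proof. by exists (PProj 0) => i a; constructor. Qed.

Lemma ucomp_const {B} {eB : encodable B} (b : B) : C (fun i (a : A) => b).
Proof.
by have [p Hp] := rawcomp_const 1 (enc b); exists p => i a; exact: Hp.
Qed.

Lemma ucomp_comp {B D} {eB : encodable B} {eD : encodable D}
  (h : I -> D -> B) (f : I -> A -> D) : C h -> C f -> C (fun i a => h i (f i a)).
Proof.
move=> [p Hp] [q Hq]; exists (PComp p [:: q]) => i a.
by econstructor; [econstructor; [exact: Hq|constructor]|exact: Hp].
Qed.

Lemma ucomp_oracle (f : I -> A -> nat) : C f -> C (fun i a => O i (f i a)).
Proof.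
move=> [q Hq]; exists (PComp POracle [:: q]) => i a.
econstructor; first by econstructor; [exact: Hq|constructor].
by rewrite enc_bool; case: (O i _) (@ev_oracle (O i) (f i a) [::]).
Qed.

Lemma ucomp_pair {B D} {eB : encodable B} {eD : encodable D}
  (f : I -> A -> B) (g : I -> A -> D) : C f -> C g -> C (fun i a => (f i a, g i a)).
Proof.
apply: ucomp_raw2; first exact: (rawcomp_npair (rawcomp_nth 2 0) (rawcomp_nth 2 1)).
by move=> d x /=.
Qed.

Lemma ucomp_fst {B D} {eB : encodable B} {eD : encodable D}
  (f : I -> A -> B * D) : C f -> C (fun i a => (f i a).1).
Proof.
apply: ucomp_raw1; first exact: (rawcomp_nfst (rawcomp_nth 1 0)).
by case=> d x; rewrite /= nfst_pair.
Qed.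

Lemma ucomp_snd {B D} {eB : encodable B} {eD : encodable D}
  (f : I -> A -> B * D) : C f -> C (fun i a => (f i a).2).
Proof.
apply: ucomp_raw1; first exact: (rawcomp_nsnd (rawcomp_nth 1 0)).
by case=> d x; rewrite /= nsnd_pair.
Qed.

Lemma ucomp_comp2 {B D E} {eB : encodable B} {eD : encodable D} {eE : encodable E}
    (h : I -> D -> E -> B) (f : I -> A -> D) (g : I -> A -> E) :
  C (fun i p => h i p.1 p.2) -> C f -> C g -> C (fun i a => h i (f i a) (g i a)).
Proof. by move=> Hh Hf Hg; apply: (ucomp_comp Hh (ucomp_pair Hf Hg)). Qed.

Lemma ucomp_succ (f : I -> A -> nat) : C f -> C (fun i a => (f i a).+1).
Proof. exact: (ucomp_raw1 (rawcomp_succ (rawcomp_nth 1 0))). Qed.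

Lemma ucomp_pred (f : I -> A -> nat) : C f -> C (fun i a => (f i a).-1).
Proof. exact: (ucomp_raw1 (rawcomp_pred (rawcomp_nth 1 0))). Qed.

Lemma ucomp_add (f g : I -> A -> nat) : C f -> C g -> C (fun i a => f i a + g i a).
Proof. exact: (ucomp_raw2 (rawcomp_add (rawcomp_nth 2 0) (rawcomp_nth 2 1))). Qed.

Lemma ucomp_sub (f g : I -> A -> nat) : C f -> C g -> C (fun i a => f i a - g i a).
Proof. exact: (ucomp_raw2 (rawcomp_sub (rawcomp_nth 2 0) (rawcomp_nth 2 1))). Qed.

Lemma ucomp_eq0 (f : I -> A -> nat) : C f -> C (fun i a => f i a == 0).
Proof.
apply: (@ucomp_raw1 _ _ _ _ (eq_op^~ 0));
  first exact: (rawcomp_if (rawcomp_nth 1 0) (rawcomp_const 1 0) (rawcomp_const 1 1)).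
by case.
Qed.

Lemma ucomp_eqn (f g : I -> A -> nat) : C f -> C g -> C (fun i a => f i a == g i a).
Proof.
move=> Hf Hg; apply: (@ucomp_ext _ _ (fun i a => neqn (f i a) (g i a) == 0)).
  by move=> i a; rewrite neqn0.
by apply: ucomp_eq0; apply: ucomp_add; apply: ucomp_sub.
Qed.

Lemma ucomp_leq (f g : I -> A -> nat) : C f -> C g -> C (fun i a => f i a <= g i a).
Proof. by move=> Hf Hg; apply: ucomp_eq0; apply: ucomp_sub. Qed.

Lemma ucomp_if {B} {eB : encodable B} (b : I -> A -> bool) (f g : I -> A -> B) :
  C b -> C f -> C g -> C (fun i a => if b i a then f i a else g i a).
Proof.
move=> [p Hp] [q Hq] [r Hr].
have [u Hu] := rawcomp_if (rawcomp_nth 3 0) (rawcomp_nth 3 1) (rawcomp_nth 3 2).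
exists (PComp u [:: p; q; r]) => i a.
have Hy : eval (O i) u [:: enc (b i a); enc (f i a); enc (g i a)]
    (enc (if b i a then f i a else g i a)).
  by case: (b i a) => /=; apply: Hu.
apply: ev_comp Hy; econstructor; [exact: Hp|econstructor; [exact: Hq|]].
by econstructor; [exact: Hr|constructor].
Qed.

Lemma ucomp_neg (f : I -> A -> bool) : C f -> C (fun i a => ~~ f i a).
Proof. by move=> Hf; apply: ucomp_if => //; apply: ucomp_const. Qed.

Lemma ucomp_and (f g : I -> A -> bool) : C f -> C g -> C (fun i a => f i a && g i a).
Proof. by move=> Hf Hg; apply: ucomp_if => //; apply: ucomp_const. Qed.

Lemma ucomp_or (f g : I -> A -> bool) : C f -> C g -> C (fun i a => f i a || g i a).
Proof. by move=> Hf Hg; apply: ucomp_if => //; apply: ucomp_const. Qed.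

Lemma ucomp_imply (f g : I -> A -> bool) : C f -> C g -> C (fun i a => f i a ==> g i a).
Proof. by move=> Hf Hg; apply: ucomp_if => //; apply: ucomp_const. Qed.

Lemma ucomp_nat_of_bool (f : I -> A -> bool) : C f -> C (fun i a => nat_of_bool (f i a)).
Proof. by apply: (ucomp_raw1 (rawcomp_nth 1 0)). Qed.

Lemma ucomp_cons {B} {eB : encodable B} (f : I -> A -> B) (g : I -> A -> seq B) :
  C f -> C g -> C (fun i a => f i a :: g i a).
Proof.
apply: ucomp_raw2; first exact: (rawcomp_succ (rawcomp_npair (rawcomp_nth 2 0) (rawcomp_nth 2 1))).
by move=> d x; rewrite enc_cons.
Qed.

Lemma ucomp_nilp {B} {eB : encodable B} (f : I -> A -> seq B) :
  C f -> C (fun i a => nilp (f i a)).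
Proof.
apply: ucomp_raw1;
  first exact: (rawcomp_if (rawcomp_nth 1 0) (rawcomp_const 1 0) (rawcomp_const 1 1)).
by case => // x l; rewrite enc_cons.
Qed.

Lemma ucomp_behead {B} {eB : encodable B} (f : I -> A -> seq B) :
  C f -> C (fun i a => behead (f i a)).
Proof.
apply: ucomp_raw1; first exact: (rawcomp_if (rawcomp_nth 1 0)
  (rawcomp_nsnd (rawcomp_pred (rawcomp_nth 1 0))) (rawcomp_const 1 0)).
by case=> // x l; rewrite enc_cons [nth _ _ _]/= nsnd_pair.
Qed.

Lemma ucomp_head {B} {eB : encodable B} (b : B) (f : I -> A -> seq B) :
  C f -> C (fun i a => head b (f i a)).
Proof.
apply: ucomp_raw1; first exact: (rawcomp_if (rawcomp_nth 1 0)
  (rawcomp_nfst (rawcomp_pred (rawcomp_nth 1 0))) (rawcomp_const 1 (enc b))).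
by case=> // x l; rewrite enc_cons [nth _ _ _]/= nfst_pair.
Qed.

(* An instance of [B] for [head] is extracted from the code [0]. *)
Lemma ucomp_match_seq {B D} {eB : encodable B} {eD : encodable D}
    (l : I -> A -> seq B) (z : I -> A -> D) (s : I -> A -> B -> seq B -> D) :
  C l -> C z -> C (fun i p => s i p.1.1 p.1.2 p.2) ->
  C (fun i a => match l i a with [::] => z i a | x :: l' => s i a x l' end).
Proof.
move=> Hl Hz Hs.
apply: (@ucomp_ext _ _ (fun i a => if nilp (l i a) then z i a
   else s i a (head (dec 0) (l i a)) (behead (l i a)))).
  by move=> i a; case: (l i a).
apply: ucomp_if; [exact: ucomp_nilp|by []|].
have := @ucomp_comp _ _ _ _ (fun i p => s i p.1.1 p.1.2 p.2)
  (fun i a => (a, head (dec 0) (l i a), behead (l i a))) Hs.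
apply; apply: ucomp_pair; last exact: ucomp_behead.
by apply: ucomp_pair; [exact: ucomp_id|exact: ucomp_head].
Qed.

Lemma ucomp_iter {B} {eB : encodable B} (n : I -> A -> nat)
    (g : I -> A -> B -> B) (z : I -> A -> B) :
  C n -> C (fun i p => g i p.1 p.2) -> C z ->
  C (fun i a => iter (n i a) (g i a) (z i a)).
Proof.
move=> [p Hp] [q Hq] [r Hr].
(* [PRec] hands its step the counter, the accumulator and [enc a]; [u] drops the counter and pairs
   the other two in the order that [g] expects. *)
have [u Hu] := rawcomp_npair (rawcomp_nth 3 2) (rawcomp_nth 3 1).
exists (PComp (PRec r (PComp q [:: u])) [:: p; PProj 0]) => i a.
apply: (@ev_comp _ _ _ _ [:: n i a; enc a]).
  by econstructor; [exact: Hp|econstructor; [exact: ev_proj|constructor]].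
elim: (n i a) => [|k IH] /=; first by constructor.
apply: ev_recS IH _; apply: (@ev_comp _ _ _ _ [:: enc (a, iter k (g i a) (z i a))]).
  by econstructor; [exact: Hu|constructor].
exact: Hq.
Qed.

End Basic.

Section Lists.
Context {A : Type} {eA : encodable A} {B : Type} {eB : encodable B}.

Lemma ucomp_foldl {D} {eD : encodable D} (g : I -> A -> D -> B -> D)
    (z : I -> A -> D) (l : I -> A -> seq B) :
  C (fun i p => g i p.1.1 p.1.2 p.2) -> C z -> C l ->
  C (fun i a => foldl (g i a) (z i a) (l i a)).
Proof.
move=> Hg Hz Hl.
(* The step consumes one list element and idles on the empty list, so it may be iterated
   [enc (l i a)] times, a computable bound on the length. *)
pose st i a (q : seq B * D) := match q.1 with [::] => q | x :: l' => (l', g i a q.2 x) end.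
have E i a m l0 d : size l0 <= m -> (iter m (st i a) (l0, d)).2 = foldl (g i a) d l0.
  elim: m l0 d => [|m IH] [|x l0] d // sl; rewrite iterSr; first by rewrite IH.
  by rewrite /st /= IH.
apply: (@ucomp_ext _ _ _ _ (fun i a => (iter (enc (l i a)) (st i a) (l i a, z i a)).2)).
  by move=> i a; rewrite E // size_enc.
apply: ucomp_snd; apply: ucomp_iter; last exact: ucomp_pair.
  by apply: (ucomp_raw1 (rawcomp_nth 1 0)) Hl.
have C1 : C (fun i (q : A * (seq B * D) * B * seq B) => q.1.1.1).
  by do 3!apply: ucomp_fst; apply: ucomp_id.
apply: ucomp_match_seq.
- by apply: ucomp_fst; apply: ucomp_snd; apply: ucomp_id.
- by apply: ucomp_snd; apply: ucomp_id.
apply: ucomp_pair; first by apply: ucomp_snd; apply: ucomp_id.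
apply: (@ucomp_comp _ _ _ _ _ _ (fun i p => g i p.1.1 p.1.2 p.2)
  (fun i q => (q.1.1.1, q.1.1.2.2, q.1.2)) Hg).
apply: ucomp_pair; last by apply: ucomp_snd; apply: ucomp_fst; apply: ucomp_id.
apply: ucomp_pair => //.
by apply: ucomp_snd; apply: ucomp_snd; do 2!apply: ucomp_fst; apply: ucomp_id.
Qed.

Lemma ucomp_rev (l : I -> A -> seq B) : C l -> C (fun i a => rev (l i a)).
Proof.
move=> Hl; apply: (@ucomp_ext _ _ _ _ (fun i a => foldl (fun d x => x :: d) [::] (l i a))).
  by move=> i a; rewrite -[in LHS](revK (l i a)) foldl_rev; elim: (rev _) => //= x s ->.
apply: ucomp_foldl => //; last exact: ucomp_const.
by apply: ucomp_cons; [|apply: ucomp_snd; apply: ucomp_fst]; try apply: ucomp_snd; apply: ucomp_id.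
Qed.

Lemma ucomp_foldr {D} {eD : encodable D} (g : I -> A -> B -> D -> D)
    (z : I -> A -> D) (l : I -> A -> seq B) :
  C (fun i p => g i p.1.1 p.1.2 p.2) -> C z -> C l ->
  C (fun i a => foldr (g i a) (z i a) (l i a)).
Proof.
move=> Hg Hz Hl.
apply: (@ucomp_ext _ _ _ _ (fun i a => foldl (fun d x => g i a x d) (z i a) (rev (l i a)))).
  by move=> i a; rewrite foldl_rev.
apply: ucomp_foldl => //; last exact: ucomp_rev.
apply: (@ucomp_comp _ _ _ _ _ _ (fun i p => g i p.1.1 p.1.2 p.2)
  (fun i q => (q.1.1, q.2, q.1.2)) Hg).
apply: ucomp_pair; last by apply: ucomp_snd; apply: ucomp_fst; apply: ucomp_id.
by apply: ucomp_pair; [apply: ucomp_fst; apply: ucomp_fst|apply: ucomp_snd]; apply: ucomp_id.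
Qed.

End Lists.

End UniformlyComputable.
Arguments ucomp {I} O {A B eA eB} f.

Lemma ucomp_comp3 {I} {O : I -> nat -> bool} {A B D E F} {eA : encodable A}
    {eB : encodable B} {eD : encodable D} {eE : encodable E} {eF : encodable F}
    (h : I -> D -> E -> F -> B) (f : I -> A -> D) (g : I -> A -> E) (k : I -> A -> F) :
  ucomp O (fun i p => h i p.1.1 p.1.2 p.2) ->
  ucomp O f -> ucomp O g -> ucomp O k ->
  ucomp O (fun i a => h i (f i a) (g i a) (k i a)).
Proof.
move=> Hh Hf Hg Hk.
exact: (ucomp_comp Hh (ucomp_pair (ucomp_pair Hf Hg) Hk)).
Qed.

(** A hook, redefined after each new group of closure lemmas so that [uc] covers them too. *)
Ltac uc_ext := fail.
Ltac uc_step :=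
  lazymatch goal with
  | |- ucomp _ (fun _ _ => ?b) => exact: (ucomp_const _ b)
  | |- ucomp _ (fun i a => a) => exact: ucomp_id
  | |- ucomp _ (fun i a => fst (@?f i a)) => apply: ucomp_fst
  | |- ucomp _ (fun i a => snd (@?f i a)) => apply: ucomp_snd
  | |- ucomp _ (fun i a => (@?f i a, @?g i a)) => apply: ucomp_pair
  | |- ucomp _ (fun i a => @?f i a :: @?g i a) => apply: ucomp_cons
  | |- ucomp _ (fun i a => S (@?f i a)) => apply: ucomp_succ
  | |- ucomp _ (fun i a => predn (@?f i a)) => apply: ucomp_pred
  | |- ucomp _ (fun i a => addn (@?f i a) (@?g i a)) => apply: ucomp_add
  | |- ucomp _ (fun i a => subn (@?f i a) (@?g i a)) => apply: ucomp_sub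
  | |- ucomp _ (fun i a => leq (@?f i a) (@?g i a)) => apply: ucomp_leq
  | |- ucomp _ (fun i a => @eq_op _ (@?f i a) (@?g i a)) =>
      first [apply: ucomp_eqn | progress uc_ext]
  | |- ucomp _ (fun i a => negb (@?f i a)) => apply: ucomp_neg
  | |- ucomp _ (fun i a => andb (@?f i a) (@?g i a)) => apply: ucomp_and
  | |- ucomp _ (fun i a => orb (@?f i a) (@?g i a)) => apply: ucomp_or
  | |- ucomp _ (fun i a => implb (@?f i a) (@?g i a)) => apply: ucomp_imply
  | |- ucomp _ (fun i a => nat_of_bool (@?f i a)) => apply: ucomp_nat_of_bool
  | |- ucomp _ (fun i a => match @?b i a with true => @?f i a | false => @?g i a end) =>
      apply: ucomp_if
  | |- ucomp _ (fun i a => behead (@?f i a)) => apply: ucomp_behead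
  | |- ucomp _ (fun i a => head _ (@?f i a)) => apply: ucomp_head
  | |- ucomp _ (fun i a => nilp (@?f i a)) => apply: ucomp_nilp
  | |- ucomp _ (fun i a => rev (@?f i a)) => apply: ucomp_rev
  | |- ucomp _ (fun i a => foldr (@?f i a) (@?z i a) (@?l i a)) => apply: ucomp_foldr
  | |- ucomp _ (fun i a => foldl (@?f i a) (@?z i a) (@?l i a)) => apply: ucomp_foldl
  | |- ucomp _ (fun i a => iter (@?n i a) (@?f i a) (@?z i a)) => apply: ucomp_iter
  | _ => first [ assumption | progress uc_ext | apply: ucomp_oracle
    | match goal with H : ucomp _ _ |- _ =>
        lazymatch type of H with
        | ucomp _ (fun i p => _ (fst (fst p)) (snd (fst p)) (snd p)) => eapply (ucomp_comp3 H)
        | ucomp _ (fun i p => _ (fst p) (snd p)) => eapply (ucomp_comp2 H)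
        | _ => eapply (ucomp_comp H)
        end
      end ]
  end; cbv beta.
Ltac uc := cbv beta zeta; repeat uc_step.

Section ListFunctions.
Context {I : Type} {O : I -> nat -> bool} {A : Type} {eA : encodable A}.
Local Notation C := (ucomp O).

Lemma ucomp_enc {B} {eB : encodable B} (f : I -> A -> B) : C f -> C (fun i a => enc (f i a)).
Proof. by apply: (ucomp_raw1 (rawcomp_nth 1 0)). Qed.

Lemma ucomp_eq {B : eqType} {eB : encodable B} (f g : I -> A -> B) :
  C f -> C g -> C (fun i a => f i a == g i a).
Proof.
move=> Hf Hg; apply: (@ucomp_ext _ _ _ _ _ _ (fun i a => enc (f i a) == enc (g i a))).
  by move=> i a; rewrite (can_eq encK).
by apply: ucomp_eqn; apply: ucomp_enc.
Qed.

Lemma ucomp_size {B} {eB : encodable B} (l : I -> A -> seq B) :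
  C l -> C (fun i a => size (l i a)).
Proof.
move=> Hl; apply: (@ucomp_ext _ _ _ _ _ _ (fun i a => foldr (fun _ n => n.+1) 0 (l i a))).
  by move=> i a; elim: (l i a) => //= x s ->.
by uc.
Qed.

Lemma ucomp_cat {B} {eB : encodable B} (l m : I -> A -> seq B) :
  C l -> C m -> C (fun i a => l i a ++ m i a).
Proof.
move=> Hl Hm; apply: (@ucomp_ext _ _ _ _ _ _ (fun i a => foldr (fun x s => x :: s) (m i a) (l i a))).
  by move=> i a; elim: (l i a) => //= x s ->.
by uc.
Qed.

Lemma ucomp_rcons {B} {eB : encodable B} (l : I -> A -> seq B) (x : I -> A -> B) :
  C l -> C x -> C (fun i a => rcons (l i a) (x i a)).
Proof.
move=> Hl Hx; apply: (@ucomp_ext _ _ _ _ _ _ (fun i a => l i a ++ [:: x i a])).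
  by move=> i a; rewrite cats1.
by apply: ucomp_cat => //; uc.
Qed.

Lemma ucomp_drop {B} {eB : encodable B} (n : I -> A -> nat) (l : I -> A -> seq B) :
  C n -> C l -> C (fun i a => drop (n i a) (l i a)).
Proof.
move=> Hn Hl; apply: (@ucomp_ext _ _ _ _ _ _ (fun i a => iter (n i a) behead (l i a))).
  by move=> i a; elim: (n i a) => /= [|k ->]; rewrite ?drop0 // -drop1 drop_drop.
by apply: ucomp_iter; uc.
Qed.

Lemma ucomp_take {B} {eB : encodable B} (n : I -> A -> nat) (l : I -> A -> seq B) :
  C n -> C l -> C (fun i a => take (n i a) (l i a)).
Proof.
move=> Hn Hl; apply: (@ucomp_ext _ _ _ _ _ _
  (fun i a => rev (drop (size (l i a) - n i a) (rev (l i a))))).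
  by move=> i a; rewrite -{3}(revK (l i a)) take_rev size_rev.
by apply: ucomp_rev; apply: ucomp_drop; uc; apply: ucomp_size.
Qed.

Lemma ucomp_nth {B} {eB : encodable B} (b : B) (l : I -> A -> seq B) (n : I -> A -> nat) :
  C l -> C n -> C (fun i a => nth b (l i a) (n i a)).
Proof.
move=> Hl Hn; apply: (@ucomp_ext _ _ _ _ _ _ (fun i a => head b (drop (n i a) (l i a)))).
  by move=> i a; rewrite -nth0 nth_drop addn0.
by apply: ucomp_head; apply: ucomp_drop.
Qed.

Lemma ucomp_map {B D} {eB : encodable B} {eD : encodable D} (f : I -> A -> B -> D)
    (l : I -> A -> seq B) :
  C (fun i p => f i p.1 p.2) -> C l -> C (fun i a => map (f i a) (l i a)).
Proof.
move=> Hf Hl; apply: (@ucomp_ext _ _ _ _ _ _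
  (fun i a => foldr (fun x s => f i a x :: s) [::] (l i a))).
  by move=> i a; elim: (l i a) => //= x s ->.
by uc.
Qed.

Lemma ucomp_all {B} {eB : encodable B} (f : I -> A -> B -> bool) (l : I -> A -> seq B) :
  C (fun i p => f i p.1 p.2) -> C l -> C (fun i a => all (f i a) (l i a)).
Proof.
move=> Hf Hl; apply: (@ucomp_ext _ _ _ _ _ _
  (fun i a => foldr (fun x b => f i a x && b) true (l i a))).
  by move=> i a; elim: (l i a) => //= x s ->.
by uc.
Qed.

Lemma ucomp_has {B} {eB : encodable B} (f : I -> A -> B -> bool) (l : I -> A -> seq B) :
  C (fun i p => f i p.1 p.2) -> C l -> C (fun i a => has (f i a) (l i a)).
Proof.
move=> Hf Hl; apply: (@ucomp_ext _ _ _ _ _ _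
  (fun i a => foldr (fun x b => f i a x || b) false (l i a))).
  by move=> i a; elim: (l i a) => //= x s ->.
by uc.
Qed.

Lemma ucomp_find {B} {eB : encodable B} (f : I -> A -> B -> bool) (l : I -> A -> seq B) :
  C (fun i p => f i p.1 p.2) -> C l -> C (fun i a => find (f i a) (l i a)).
Proof.
move=> Hf Hl; apply: (@ucomp_ext _ _ _ _ _ _
  (fun i a => foldr (fun x n => if f i a x then 0 else n.+1) 0 (l i a))).
  by move=> i a; elim: (l i a) => //= x s ->.
by uc.
Qed.

End ListFunctions.

Section MoreFunctions.
Context {I : Type} {O : I -> nat -> bool} {A : Type} {eA : encodable A}.
Local Notation C := (ucomp O).

Lemma ucomp_iota (m n : I -> A -> nat) : C m -> C n -> C (fun i a => iota (m i a) (n i a)).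
Proof.
move=> Hm Hn; apply: (@ucomp_ext _ _ _ _ _ _
  (fun i a => iter (n i a) (fun l => (m i a + n i a - (size l).+1) :: l) [::])).
  move=> i a; set l := iter _ _ _.
  suff E k : k <= n i a -> iter k (fun l => (m i a + n i a - (size l).+1) :: l) [::] =
     iota (m i a + n i a - k) k by rewrite /l E // addnK.
  elim: k => [|k IH] //= lk; rewrite IH; last exact: ltnW.
  rewrite size_iota; congr (_ :: iota _ _); lia.
by apply: ucomp_iter; uc; apply: ucomp_size; uc.
Qed.

Lemma ucomp_odd (f : I -> A -> nat) : C f -> C (fun i a => odd (f i a)).
Proof.
move=> Hf; apply: (@ucomp_ext _ _ _ _ _ _ (fun i a => iter (f i a) negb false)).
  by move=> i a; elim: (f i a) => //= n ->.
by apply: ucomp_iter; uc.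
Qed.

Lemma ucomp_half (f : I -> A -> nat) : C f -> C (fun i a => (f i a)./2).
Proof.
move=> Hf; apply: (@ucomp_ext _ _ _ _ _ _ (fun i a => (iter (f i a)
    (fun p => (~~ p.1, if p.1 then p.2.+1 else p.2)) (false, 0)).2)).
  move=> i a; set p := iter _ _ _; suff -> : p = (odd (f i a), (f i a)./2) by [].
  by rewrite /p; elim: (f i a) => //= n -> /=; rewrite uphalf_half; case: (odd n).
by uc.
Qed.

Lemma ucomp_double (f : I -> A -> nat) : C f -> C (fun i a => (f i a).*2).
Proof.
move=> Hf; apply: (@ucomp_ext _ _ _ _ _ _ (fun i a => f i a + f i a)).
  by move=> i a; rewrite addnn.
by uc.
Qed.

Lemma ucomp_dec_nat (f : I -> A -> nat) : C f -> C (fun i a => dec (f i a) : nat).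
Proof. by []. Qed.

Lemma ucomp_dec_bool (f : I -> A -> nat) : C f -> C (fun i a => dec (f i a) : bool).
Proof. by move=> Hf; rewrite /dec /=; uc. Qed.

Lemma ucomp_dec_prod {B D} {eB : encodable B} {eD : encodable D} (f : I -> A -> nat) :
  C (fun i a => dec a : B) -> C (fun i a => dec a : D) -> C f ->
  C (fun i a => dec (f i a) : B * D).
Proof.
move=> HB HD Hf; rewrite {1}/dec /=; apply: ucomp_pair.
  apply: (ucomp_comp HB); apply: (ucomp_raw1 (rawcomp_nfst (rawcomp_nth 1 0))) Hf.
  by [].
apply: (ucomp_comp HD); apply: (ucomp_raw1 (rawcomp_nsnd (rawcomp_nth 1 0))) Hf.
by [].
Qed.

Lemma ucomp_dec_seq {B} {eB : encodable B} (f : I -> A -> nat) :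
  C (fun i a => dec a : B) -> C f -> C (fun i a => dec (f i a) : seq B).
Proof.
move=> HB Hf; rewrite {1}/dec /=; apply: ucomp_map; uc.
apply: (ucomp_raw1 (rawcomp_nth 1 0)) Hf => n.
by rewrite /enc /= map_id CodeSeq.decodeK.
Qed.

Lemma ucomp_code (f : I -> A -> seq nat) : C f -> C (fun i a => CodeSeq.code (f i a)).
Proof.
apply: (ucomp_raw1 (rawcomp_nth 1 0)) => l.
by rewrite [in RHS]/enc /= map_id.
Qed.

Lemma ucomp_decode (f : I -> A -> nat) : C f -> C (fun i a => CodeSeq.decode (f i a)).
Proof.
apply: (ucomp_raw1 (rawcomp_nth 1 0)) => n.
by rewrite /enc /= map_id CodeSeq.decodeK.
Qed.

End MoreFunctions.

Ltac uc_lists :=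
  lazymatch goal with
  | |- ucomp _ (fun i a => size (@?f i a)) => apply: ucomp_size
  | |- ucomp _ (fun i a => cat (@?f i a) (@?g i a)) => apply: ucomp_cat
  | |- ucomp _ (fun i a => rcons (@?f i a) (@?g i a)) => apply: ucomp_rcons
  | |- ucomp _ (fun i a => drop (@?f i a) (@?g i a)) => apply: ucomp_drop
  | |- ucomp _ (fun i a => take (@?f i a) (@?g i a)) => apply: ucomp_take
  | |- ucomp _ (fun i a => nth _ (@?f i a) (@?g i a)) => apply: ucomp_nth
  | |- ucomp _ (fun i a => map (@?f i a) (@?g i a)) => apply: ucomp_map
  | |- ucomp _ (fun i a => all (@?f i a) (@?g i a)) => apply: ucomp_all
  | |- ucomp _ (fun i a => has (@?f i a) (@?g i a)) => apply: ucomp_has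
  | |- ucomp _ (fun i a => find (@?f i a) (@?g i a)) => apply: ucomp_find
  | |- ucomp _ (fun i a => iota (@?f i a) (@?g i a)) => apply: ucomp_iota
  | |- ucomp _ (fun i a => odd (@?f i a)) => apply: ucomp_odd
  | |- ucomp _ (fun i a => half (@?f i a)) => apply: ucomp_half
  | |- ucomp _ (fun i a => double (@?f i a)) => apply: ucomp_double
  | |- ucomp _ (fun i a => eq_op (@?f i a) (@?g i a)) => apply: ucomp_eq
  | |- ucomp _ (fun i a => CodeSeq.code (@?f i a)) => apply: ucomp_code
  | |- ucomp _ (fun i a => CodeSeq.decode (@?f i a)) => apply: ucomp_decode
  | |- ucomp _ (fun i a => enc (@?f i a)) => apply: ucomp_enc
  | |- ucomp _ (fun i a => @dec nat _ (@?f i a)) => apply: ucomp_dec_nat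
  | |- ucomp _ (fun i a => @dec bool _ (@?f i a)) => apply: ucomp_dec_bool
  | |- ucomp _ (fun i a => @dec (_ * _) _ (@?f i a)) => apply: ucomp_dec_prod
  | |- ucomp _ (fun i a => @dec (seq _) _ (@?f i a)) => apply: ucomp_dec_seq
  end.
Ltac uc_ext ::= uc_lists.

(** Sigma_1 in [O i], with one matrix for all [i]. The uniformity allows all the oracles [join Y Q]
    to be handled at once, which is how a Pi_1 class of sets [Y] gets an index. *)
Definition uce {I} (O : I -> nat -> bool) {A} {eA : encodable A} (R : I -> A -> Prop) :=
  exists2 P : I -> A -> nat -> bool,
    ucomp O (fun i p => P i p.1 p.2) & forall i a, R i a <-> exists n, P i a n.

(** Unbounded search over codes of witnesses. The decoder of the witness type has to be computable,
    which [encodable] alone does not guarantee. *)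
Lemma ucomp_search {I} {O : I -> nat -> bool} {A} {eA : encodable A} {B} {eB : encodable B}
    (P : I -> A -> B -> bool) :
  ucomp O (fun i (n : nat) => dec n : B) ->
  ucomp O (fun i p => P i p.1 p.2) -> (forall i a, exists n, P i a n) ->
  exists2 f, ucomp O f & forall i a, P i a (f i a).
Proof.
move=> HB HP ex.
have ex' i a : exists n, P i a (dec n) by have [n Pn] := ex i a; exists (enc n); rewrite encK.
exists (fun i a => dec (ex_minn (ex' i a))); last by move=> i a; case: ex_minnP.
apply: (ucomp_comp HB).
(* Minimisation looks for a zero, so the test is negated. *)
have [p Hp] : ucomp O (fun i (q : A * nat) => ~~ P i q.1 (dec q.2)) by uc.
have [u Hu] := rawcomp_npair (rawcomp_nth 2 1) (rawcomp_nth 2 0).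
exists (PMu (PComp p [:: u])) => i a.
have E n : eval (O i) (PComp p [:: u]) [:: n; enc a] (~~ P i a (dec n)).
  apply: (@ev_comp _ _ _ _ [:: enc (a, n)]); last exact: Hp.
  by econstructor; [exact: Hu|constructor].
case: ex_minnP => n Pn nmin; constructor; first by have := E n; rewrite Pn.
move=> m lm; exists 0; have := E m; case: (boolP (P i a (dec m))) => // Pm.
by move: (nmin _ Pm); rewrite leqNgt lm.
Qed.

(** The programs below a [PComp] sit inside a list; this principle supplies induction hypotheses for
    them as well. *)
Lemma prf_nested_ind (P : prf -> Prop) :
  P PZero -> P PSucc -> (forall i, P (PProj i)) -> P POracle ->
  (forall f gs, P f -> foldr (fun g => and (P g)) True gs -> P (PComp f gs)) ->
  (forall f g, P f -> P g -> P (PRec f g)) -> (forall f, P f -> P (PMu f)) ->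
  forall p, P p.
Proof.
move=> h0 h1 h2 h3 h4 h5 h6; fix IH 1; case=> [||i||f gs|f g|f].
- exact: h0.
- exact: h1.
- exact: h2.
- exact: h3.
- apply: h4; first exact: IH.
  by elim: gs => [|g gs IHg] /=; [|split; [exact: IH|exact: IHg]].
- by apply: h5; exact: IH.
- by apply: h6; exact: IH.
Qed.

(** Answers oracle calls by running [q]. [POracle] reads only the head of its argument list, hence
    [PProj 0]. *)
Fixpoint psubst (q p : prf) : prf :=
  match p with
  | POracle => PComp q [:: PProj 0]
  | PComp f gs => PComp (psubst q f) (map (psubst q) gs)
  | PRec f g => PRec (psubst q f) (psubst q g)
  | PMu f => PMu (psubst q f)
  | _ => p
  end.

Lemma eval_psubst X (Y : nat -> bool) q : (forall x, eval X q [:: x] (Y x)) ->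
  forall p v y, eval Y p v y -> eval X (psubst q p) v y.
Proof.
move=> Hq; elim/prf_nested_ind => [||i||f gs IHf IHgs|f g IHf IHg|f IHf] v y /=.
- by move=> H; inversion H; subst; constructor.
- by move=> H; inversion H; subst; constructor.
- by move=> H; inversion H; subst; constructor.
- move=> H; inversion H; subst; apply: (@ev_comp _ _ _ _ [:: x]).
    by constructor; [exact: (@ev_proj X 0 (x :: v0))|constructor].
  by have := Hq x; case: (Y x).
- move=> H; inversion H as [| | | |? ? ? ws ? Hgs Hf| | |]; subst.
  apply: (@ev_comp _ _ _ _ ws); last exact: IHf.
  elim: gs IHgs ws Hgs {H Hf} => [|g gs IH] /= IHgs ws Hgs.
    by inversion Hgs; constructor.
  inversion Hgs as [|? ? ? z zs Hz Hzs]; subst; case: IHgs => IHg IHgs.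
  by constructor; [exact: IHg|exact: IH].
- case: v => [|n v] H; first by inversion H.
  elim: n y H => [|n IHn] y H; inversion H; subst; first by constructor; exact: IHf.
  by econstructor; [apply: IHn; eassumption|exact: IHg].
- move=> H; inversion H as [| | | | | | |? ? n H0 Hm]; subst; constructor; first exact: IHf.
  by move=> m /Hm[k Hk]; exists k; exact: IHf.
Qed.

Lemma ucomp_lift {I J} (O : I -> nat -> bool) (O' : J -> nat -> bool) (h : J -> I)
    {A B} {eA : encodable A} {eB : encodable B} (f : I -> A -> B) :
  ucomp O' (fun j x => O (h j) x) -> ucomp O f -> ucomp O' (fun j a => f (h j) a).
Proof.
move=> [q Hq] [p Hp]; exists (psubst q p) => j a.
exact: (eval_psubst (Hq j) (Hp _ _)).
Qed.

Lemma eval_det X p v y y' : eval X p v y -> eval X p v y' -> y = y'.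
Proof.
elim/prf_nested_ind: p v y y' => [||i||f gs IHf IHgs|f g IHf IHg|f IHf] v y y'.
- by move=> H1 H2; inversion H1; inversion H2.
- by case: v => [|x v] H1 H2; inversion H1; inversion H2; subst.
- by move=> H1 H2; inversion H1; inversion H2.
- by case: v => [|x v] H1 H2; inversion H1; inversion H2; subst.
- move=> H1 H2; inversion H1 as [| | | |? ? ? ws ? Hgs Hf| | |]; subst.
  inversion H2 as [| | | |? ? ? ws' ? Hgs' Hf'| | |]; subst.
  suff e : ws = ws' by move: Hf'; rewrite -e; exact: IHf Hf.
  elim: gs IHgs ws ws' Hgs Hgs' {H1 H2 Hf Hf'} => [|g gs IH] /= IHgs ws ws' Hgs Hgs'.
    by inversion Hgs; inversion Hgs'.
  inversion Hgs as [|? ? ? z zs Hz Hzs]; subst.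
  inversion Hgs' as [|? ? ? z' zs' Hz' Hzs']; subst; case: IHgs => IHg IHgs.
  by rewrite (IHg _ _ _ Hz Hz') (IH IHgs _ _ Hzs Hzs').
- case: v => [|n v] H1; first by inversion H1.
  elim: n y y' H1 => [|n IHn] y y' H1 H2;
    inversion H1 as [| | | | |? ? ? ? Hf|? ? ? ? z ? Hn Hg|];
    inversion H2 as [| | | | |? ? ? ? Hf'|? ? ? ? z' ? Hn' Hg'|]; subst.
    exact: IHf Hf Hf'.
  by move: Hg'; rewrite -(IHn _ _ Hn Hn'); exact: IHg Hg.
- move=> H1 H2; inversion H1 as [| | | | | | |? ? n H0 Hm]; subst.
  inversion H2 as [| | | | | | |? ? n' H0' Hm']; subst.
  (* If the two results of the minimisation differed, [f] would be both zero and positive at the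
     smaller one. *)
  case: (ltngtP y y') => // l; first by have [k /(IHf _ _ _ H0)] := Hm' _ l.
  by have [k /(IHf _ _ _ H0')] := Hm _ l.
Qed.

(** A second numbering of programs, whose constructors and destructors are plainly computable.
    [ucomp_program] links it to the numbering that the jump uses. *)
Fixpoint penc (p : prf) : nat :=
  match p with
  | PZero => npair 0 0
  | PSucc => npair 1 0
  | PProj i => npair 2 i
  | POracle => npair 3 0
  | PComp f gs => npair 4 (npair (penc f) (CodeSeq.code (map penc gs)))
  | PRec f g => npair 5 (npair (penc f) (penc g))
  | PMu f => npair 6 (penc f)
  end.

Lemma penc_inj : injective penc.
Proof.
elim/prf_nested_ind => [||i||f gs IHf IHgs|f g IHf IHg|f IHf] [||i'||f' gs'|f' g'|f'];
  move=> /npair_inj[] //.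
- by move=> _ ->.
- move=> _ /npair_inj[/IHf -> /(can_inj CodeSeq.codeK) e]; congr PComp.
  elim: gs gs' IHgs e => [|g gs IH] [|g' gs'] //= [IHg IHgs] [/IHg -> e].
  by rewrite (IH gs').
- by move=> _ /npair_inj[/IHf -> /IHg ->].
- by move=> _ /IHf ->.
Qed.

Lemma pencK : cancel penc (fun n => epsilon (inhabits PZero) (fun p => penc p = n)).
Proof.
move=> p; apply: penc_inj.
by apply: (epsilon_spec (inhabits PZero) (fun p' => penc p' = penc p)); exists p.
Qed.

#[export] Instance prf_enc_instance : encodable prf := Encodable pencK.

(** * Computable operations on programs *)

Definition ptag p := match p with
  PZero => 0 | PSucc => 1 | PProj _ => 2 | POracle => 3 | PComp _ _ => 4
  | PRec _ _ => 5 | PMu _ => 6 end.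
Definition pindex p := if p is PProj i then i else 0.
Definition phead p := match p with PComp f _ => f | PRec f _ => f | PMu f => f | _ => PZero end.
Definition pstep p := if p is PRec _ g then g else PZero.
Definition pargs p := if p is PComp _ gs then gs else [::].

Section PrfComputable.
Context {I : Type} {O : I -> nat -> bool} {A : Type} {eA : encodable A}.
Local Notation C := (ucomp O).

Lemma ucomp_nfst (f : I -> A -> nat) : C f -> C (fun i a => nfst (f i a)).
Proof. exact: (ucomp_raw1 (rawcomp_nfst (rawcomp_nth 1 0))). Qed.
Lemma ucomp_nsnd (f : I -> A -> nat) : C f -> C (fun i a => nsnd (f i a)).
Proof. exact: (ucomp_raw1 (rawcomp_nsnd (rawcomp_nth 1 0))). Qed.
Lemma ucomp_npair (f g : I -> A -> nat) : C f -> C g -> C (fun i a => npair (f i a) (g i a)).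
Proof. exact: (ucomp_raw2 (rawcomp_npair (rawcomp_nth 2 0) (rawcomp_nth 2 1))). Qed.

Lemma ucomp_of_code {B} {eB : encodable B} (k : I -> A -> nat) (f : I -> A -> B) :
  C k -> (forall i a, enc (f i a) = k i a) -> C f.
Proof. by move=> [p Hp] e; exists p => i a; rewrite e; apply: Hp. Qed.

Variable f : I -> A -> prf.
Hypothesis Hf : C f.
Let Hc : C (fun i a => enc (f i a)) := ucomp_enc Hf.
Let Ht : C (fun i a => nfst (enc (f i a))) := ucomp_nfst Hc.
Let Hs : C (fun i a => nsnd (enc (f i a))) := ucomp_nsnd Hc.

Lemma ucomp_ptag : C (fun i a => ptag (f i a)).
Proof.
apply: ucomp_ext Ht => i a.
by rewrite /enc /=; case: (f i a) => *; rewrite [LHS]nfst_pair.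
Qed.

Lemma ucomp_pindex : C (fun i a => pindex (f i a)).
Proof.
apply: (@ucomp_ext _ _ _ _ _ _ (fun i a => if ptag (f i a) == 2 then nsnd (enc (f i a)) else 0)).
  by move=> i a; rewrite /enc /=; case: (f i a) => //= j; rewrite nsnd_pair.
by apply: ucomp_if => //; [apply: ucomp_eqn; [exact: ucomp_ptag|]|]; exact: ucomp_const.
Qed.

Lemma ucomp_phead : C (fun i a => phead (f i a)).
Proof.
apply: (@ucomp_of_code _ _ (fun i a => if ptag (f i a) == 6 then nsnd (enc (f i a)) else
    if 4 <= ptag (f i a) then nfst (nsnd (enc (f i a))) else enc PZero)).
  apply: ucomp_if => //; first by apply: ucomp_eqn; [exact: ucomp_ptag|exact: ucomp_const].
  apply: ucomp_if; first by apply: ucomp_leq; [exact: ucomp_const|exact: ucomp_ptag].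
    exact: ucomp_nfst.
  exact: ucomp_const.
by move=> i a; rewrite /enc /=; case: (f i a) => //= *; rewrite ?nsnd_pair ?nfst_pair.
Qed.

Lemma ucomp_pstep : C (fun i a => pstep (f i a)).
Proof.
apply: (@ucomp_of_code _ _ (fun i a => if ptag (f i a) == 5 then nsnd (nsnd (enc (f i a)))
    else enc PZero)).
  apply: ucomp_if => //; first by apply: ucomp_eqn; [exact: ucomp_ptag|exact: ucomp_const].
    exact: ucomp_nsnd.
  exact: ucomp_const.
by move=> i a; rewrite /enc /=; case: (f i a) => //= *; rewrite ?nsnd_pair.
Qed.

Lemma ucomp_pargs : C (fun i a => pargs (f i a)).
Proof.
apply: (@ucomp_of_code _ _ (fun i a => if ptag (f i a) == 4 then nsnd (nsnd (enc (f i a)))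
    else 0)).
  apply: ucomp_if => //; first by apply: ucomp_eqn; [exact: ucomp_ptag|exact: ucomp_const].
    exact: ucomp_nsnd.
  exact: ucomp_const.
by move=> i a; rewrite /enc /=; case: (f i a) => //= *; rewrite ?nsnd_pair.
Qed.

Lemma ucomp_PProj (k : I -> A -> nat) : C k -> C (fun i a => PProj (k i a)).
Proof.
move=> Hk; apply: ucomp_of_code (ucomp_npair (ucomp_const _ 2) Hk) _.
by [].
Qed.

Lemma ucomp_PComp (l : I -> A -> seq prf) : C l -> C (fun i a => PComp (f i a) (l i a)).
Proof.
move=> Hl; apply: ucomp_of_code (ucomp_npair (ucomp_const _ 4)
  (ucomp_npair Hc (ucomp_enc Hl))) _.
by [].
Qed.

Lemma ucomp_PRec (g : I -> A -> prf) : C g -> C (fun i a => PRec (f i a) (g i a)).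
Proof.
move=> Hg; apply: ucomp_of_code (ucomp_npair (ucomp_const _ 5)
  (ucomp_npair Hc (ucomp_enc Hg))) _.
by [].
Qed.

Lemma ucomp_PMu : C (fun i a => PMu (f i a)).
Proof. by apply: ucomp_of_code (ucomp_npair (ucomp_const _ 6) Hc) _. Qed.

End PrfComputable.

Ltac uc_prf :=
  lazymatch goal with
  | |- ucomp _ (fun i a => ptag (@?f i a)) => apply: ucomp_ptag
  | |- ucomp _ (fun i a => pindex (@?f i a)) => apply: ucomp_pindex
  | |- ucomp _ (fun i a => phead (@?f i a)) => apply: ucomp_phead
  | |- ucomp _ (fun i a => pstep (@?f i a)) => apply: ucomp_pstep
  | |- ucomp _ (fun i a => pargs (@?f i a)) => apply: ucomp_pargs
  | |- ucomp _ (fun i a => PProj (@?f i a)) => apply: ucomp_PProj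
  | |- ucomp _ (fun i a => PComp (@?f i a) (@?g i a)) => apply: ucomp_PComp
  | |- ucomp _ (fun i a => PRec (@?f i a) (@?g i a)) => apply: ucomp_PRec
  | |- ucomp _ (fun i a => PMu (@?f i a)) => apply: ucomp_PMu
  | |- _ => uc_lists
  end.
Ltac uc_ext ::= uc_prf.

(** * The universal machine *)

Local Notation frame := (nat * prf * seq prf * seq nat * seq nat)%type.
Local Notation mstate := (bool * prf * seq nat * seq frame)%type.

(** The flag tells whether a program is to be run on an argument list or a value, kept as a
    one-element list, is to be handed to the top frame. A frame holds its tag, the program to run
    next, the argument programs still to be evaluated, the saved arguments, and the values collected
    so far (for a minimisation, the counter). *)
Definition running p v (K : seq frame) : mstate := (true, p, v, K).
Definition returning y (K : seq frame) : mstate := (false, PZero, [:: y], K).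
Definition halted (c : mstate) := ~~ c.1.1.1 && nilp c.2.

(* A stack machine for [prf]. Frames are tagged 0 (remaining arguments of a
   composition), 1 (pending step of a recursion) and 2 (running minimisation).
   The oracle answers [o x] only where [d x] holds; elsewhere, and on missing
   arguments, the machine stays in place forever. *)
Definition mstep (d o : nat -> bool) (c : mstate) : mstate :=
  let p := c.1.1.2 in let v := c.1.2 in let K := c.2 in
  if c.1.1.1 then
    if ptag p == 0 then returning 0 K
    else if ptag p == 1 then (if nilp v then c else returning (head 0 v).+1 K)
    else if ptag p == 2 then returning (nth 0 v (pindex p)) K
    else if ptag p == 3 then
      (if ~~ nilp v && d (head 0 v) then returning (nat_of_bool (o (head 0 v))) K else c)
    else if ptag p == 4 then
      (if nilp (pargs p) then running (phead p) [::] K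
       else running (head PZero (pargs p)) v
              ((0, phead p, behead (pargs p), v, [::]) :: K))
    else if ptag p == 5 then
      (if nilp v then c
       else if head 0 v == 0 then running (phead p) (behead v) K
       else running p ((head 0 v).-1 :: behead v)
              ((1, pstep p, [::], (head 0 v).-1 :: behead v, [::]) :: K))
    else running (phead p) (0 :: v) ((2, phead p, [::], v, [:: 0]) :: K)
  else if nilp K then c
  else
    let y := head 0 v in
    let t := (head (0, PZero, [::], [::], [::]) K).1.1.1.1 in
    let f := (head (0, PZero, [::], [::], [::]) K).1.1.1.2 in
    let gs := (head (0, PZero, [::], [::], [::]) K).1.1.2 in
    let w := (head (0, PZero, [::], [::], [::]) K).1.2 in
    let ws := (head (0, PZero, [::], [::], [::]) K).2 in
    let K' := behead K in
    if t == 0 then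
      (if nilp gs then running f (rcons ws y) K'
       else running (head PZero gs) w ((0, f, behead gs, w, rcons ws y) :: K'))
    else if t == 1 then running f (head 0 w :: y :: behead w) K'
    else if y == 0 then returning (head 0 ws) K'
    else running f ((head 0 ws).+1 :: w) ((2, f, [::], w, [:: (head 0 ws).+1]) :: K').

Lemma mstep_halted d o c : halted c -> mstep d o c = c.
Proof. by case: c => [[[[] p] v] K] //=; rewrite /halted /mstep /= => ->. Qed.

Lemma iter_mstep_halted d o c k : halted c -> iter k (mstep d o) c = c.
Proof. by move=> h; elim: k => //= k ->; apply: mstep_halted. Qed.

Lemma iter_mstep_stuck d o c k : mstep d o c = c -> iter k (mstep d o) c = c.
Proof. by move=> e; elim: k => //= k ->. Qed.

Section Correctness.
Variable X : nat -> bool.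
Local Notation st := (mstep xpredT X).
Local Notation reach c c' := (exists k, iter k st c = c').

Lemma reach_trans c c' c'' : reach c c' -> reach c' c'' -> reach c c''.
Proof. by move=> [k e] [l e']; exists (l + k); rewrite iterD e. Qed.

Lemma reach_step c c' : reach (st c) c' -> reach c c'.
Proof. by move=> [k e]; exists k.+1; rewrite iterSr. Qed.

Lemma reach_refl c : reach c c. Proof. by exists 0. Qed.

Lemma machine_complete p v y K :
  eval X p v y -> reach (running p v K) (returning y K).
Proof.
elim/prf_nested_ind: p v y K => [||i||f gs IHf IHgs|f g IHf IHg|f IHf] v y K H.
- by inversion H; subst; apply: reach_step; apply: reach_refl.
- by inversion H; subst; apply: reach_step; apply: reach_refl.
- by inversion H; subst; apply: reach_step; apply: reach_refl.
- inversion H; subst; apply: reach_step; rewrite /mstep /=.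
  by case: (X x); apply: reach_refl.
- inversion H as [| | | |? ? ? ws ? Hgs Hf| | |]; subst; apply: reach_step.
  case: gs IHgs Hgs {H} => [|g gs] /= IHgs Hgs.
    by inversion Hgs; subst; rewrite /mstep /=; apply: IHf.
  rewrite /mstep /= -/(running _ _ _).
  (* Generalising over the values [us] already collected makes the induction on the remaining
     arguments work. *)
  suff H us : reach (running g v ((0, f, gs, v, us) :: K)) (running f (us ++ ws) K).
    exact: reach_trans (H [::]) (IHf _ _ _ Hf).
  elim: gs g IHgs ws us Hgs {Hf} => [|g' gs IH] g [IHg IHgs] ws us Hgs;
    inversion Hgs as [|? ? ? z zs Hz Hzs]; subst;
    apply: reach_trans (IHg _ _ _ Hz) (reach_step _); rewrite /mstep /=.
    by inversion Hzs; rewrite cats1; apply: reach_refl.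
  by rewrite -cat_rcons; apply: IH.
- case: v H => [|n v] H; first by inversion H.
  elim: n y K H => [|n IHn] y K H; inversion H as [| | | | |? ? ? ? Hf|? ? ? ? z ? Hn Hg|];
    subst; apply: reach_step; rewrite /mstep /=; first exact: IHf.
  apply: reach_trans (IHn _ _ Hn) (reach_step _); rewrite /mstep /=.
  exact: IHg.
- inversion H as [| | | | | | |? ? n H0 Hm]; subst; apply: reach_step; rewrite /mstep /=.
  (* The counter climbs up to [y] because every earlier run of [f] returns a positive value. *)
  suff R m : m <= y -> reach (running f (0 :: v) ((2, f, [::], v, [:: 0]) :: K))
    (running f (m :: v) ((2, f, [::], v, [:: m]) :: K)).
    apply: reach_trans (R y (leqnn _)) (reach_trans (IHf _ _ _ H0) (reach_step _)).
    exact: reach_refl.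
  elim: m => [_|m IHm lm]; first exact: reach_refl.
  have [k Hk] := Hm m lm.
  apply: reach_trans (IHm (ltnW lm)) (reach_trans (IHf _ _ _ Hk) (reach_step _)).
  exact: reach_refl.
Qed.

(** A halting run must first return the value of its current program. That fewer steps are left
    afterwards permits strong induction on their number in the minimisation case, where [f] is run
    an unknown number of times. *)
Lemma machine_sound p k v K :
  halted (iter k st (running p v K)) ->
  exists y k', [/\ k' < k, eval X p v y & halted (iter k' st (returning y K))].
Proof.
elim/prf_nested_ind: p k v K => [||i||f gs IHf IHgs|f g IHf IHg|f IHf] k v K.
- case: k => [|k] // H; exists 0, k; split=> //; first by constructor.
  by move: H; rewrite iterSr.
- case: k => [|k] //; case: v => [|x v] H; last first.
    by exists x.+1, k; split=> //; [constructor|move: H; rewrite iterSr].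
  by move: H; rewrite iter_mstep_stuck.
- case: k => [|k] // H; exists (nth 0 v i), k; split=> //; first by constructor.
  by move: H; rewrite iterSr.
- case: k => [|k] //; case: v => [|x v] H; last first.
    exists (X x), k; split=> //; last by move: H; rewrite iterSr.
    by have := @ev_oracle X x v; case: (X x).
  by move: H; rewrite iter_mstep_stuck.
- case: k => [|k] //; rewrite iterSr; case: gs IHgs => [|g gs] IHgs.
    rewrite {2}/mstep /= => /IHf[y [k' [lk Hy Hk]]]; exists y, k'.
    by split=> //; [exact: ltn_trans lk _|econstructor; [constructor|exact: Hy]].
  rewrite {2}/mstep /= -/(running _ _ _) => H.
  suff /(_ [::])[//|ws [k' [lk Hws Hk]]] : forall us,
     halted (iter k st (running g v ((0, f, gs, v, us) :: K))) ->
     exists ws k', [/\ k' <= k, evals X (g :: gs) v ws &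
       halted (iter k' st (running f (us ++ ws) K))].
    have [y [l [ll Hy Hl]]] := IHf _ _ _ Hk; exists y, l; split=> //.
      by rewrite ltnS (leq_trans (ltnW ll)).
    by econstructor; [exact: Hws|exact: Hy].
  elim: gs g k IHgs {H} => [|g' gs IH] g k /= [IHg IHgs] us /IHg[y [[|l] [ll Hy]]] //;
    rewrite iterSr {2}/mstep /= -/(running _ _ _).
    move=> Hl; exists [:: y], l; split; first exact: ltnW (ltnW _).
      by constructor => //; constructor.
    by rewrite cats1.
  move=> /(IH _ _ IHgs)[ws [k' [lk Hws Hk]]]; exists (y :: ws), k'; split.
  + by apply: leq_trans lk _; apply: ltnW; apply: ltnW.
  + by constructor.
  + by rewrite -cat_rcons.
- case: v => [|n v].
    by rewrite iter_mstep_stuck.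
  elim: n k K => [|n IHn] [|k] K //; rewrite iterSr {2}/mstep /=.
    move=> /IHf[y [k' [lk Hy Hk]]]; exists y, k'; split=> //; last by constructor.
    exact: ltn_trans lk _.
  move=> /IHn[z [[|l] [ll Hz]]] //; rewrite iterSr {2}/mstep /=.
  move=> /IHg[y [k' [lk Hy Hk]]]; exists y, k'; split=> //; last by econstructor; eassumption.
  by apply: ltn_trans lk _; lia.
- case: k => [|k] //; rewrite iterSr {2}/mstep /= -/(running _ _ _).
  suff H m l : l <= k -> (forall m', m' < m -> exists z, eval X f (m' :: v) z.+1) ->
     halted (iter l st (running f (m :: v) ((2, f, [::], v, [:: m]) :: K))) ->
     exists y k', [/\ k' < k.+1, eval X (PMu f) v y & halted (iter k' st (returning y K))].
    exact: H.
  elim/ltn_ind: l m => l IHl m lk Hm /IHf[z [[|l'] [ll Hz]]] //.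
  rewrite iterSr {2}/mstep /=; case: z Hz => [|z] Hz /= Hl.
    by exists m, l'; split=> //; [lia|constructor].
  apply: (IHl l' _ m.+1) => //; [exact: ltnW|by lia|].
  by move=> m'; rewrite ltnS leq_eqVlt => /predU1P[->|/Hm //]; exists z.
Qed.

Lemma eval_halted p v :
  (exists y, eval X p v y) <-> exists k, halted (iter k st (running p v [::])).
Proof.
split=> [[y /(@machine_complete _ _ _ [::])[k Hk]]|[k /machine_sound[y [k' [_ Hy _]]]]].
  by exists k; rewrite Hk.
by exists y.
Qed.

(** Each step consults the oracle at most at the head of the current argument list, so the maximum
    over [k] steps bounds the use. *)
Lemma finite_use c k : exists m0, forall m (d o : nat -> bool), m0 <= m ->
  (forall x, x < m -> d x /\ o x = X x) -> iter k (mstep d o) c = iter k st c.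
Proof.
elim: k => [|k [m0 IH]]; first by exists 0.
exists (maxn m0 (head 0 (iter k st c).1.2).+1) => m d o; rewrite geq_max => /andP[lm lh] H.
rewrite /= (IH _ _ _ lm H); case: (H _ lh) => Hd Ho.
by rewrite /mstep Hd Ho.
Qed.

End Correctness.

Definition strd (s : seq bool) x := x < size s.

Lemma mstep_mono (d o d' o' : nat -> bool) c :
  (forall x, d x -> d' x /\ o x = o' x) ->
  mstep d o c = c \/ mstep d o c = mstep d' o' c.
Proof.
move=> H; case: (boolP (d (head 0 c.1.2))) => Hd.
  by have [Hd' Ho] := H _ Hd; right; rewrite /mstep Hd Hd' Ho.
case: c Hd => [[[[] p] v] K] /= Hd; last by right.
by case: p => [||i||f gs|f g|f]; first [by right | by left; rewrite /mstep /= (negbTE Hd) andbF].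
Qed.

Lemma halted_mono (d o d' o' : nat -> bool) c k :
  (forall x, d x -> d' x /\ o x = o' x) ->
  halted (iter k (mstep d o) c) -> halted (iter k (mstep d' o') c).
Proof.
move=> H; elim: k c => [//|k IH] c; rewrite !iterSr.
case: (mstep_mono c H) => [e|<-]; last exact: IH.
by rewrite e iter_mstep_stuck // => h; rewrite mstep_halted // iter_mstep_halted.
Qed.

(** Convergence of program [e] on input [e] with [s] as partial oracle and [size s] as time bound.
    Being decidable and monotone in [s], it is the finite approximation to the jump. *)
Definition hlt (s : seq bool) (e : nat) :=
  halted (iter (size s) (mstep (strd s) (nth false s)) (running (program e) [:: e] [::])).

Lemma hlt_mono s s' e : prefix s s' -> hlt s e -> hlt s' e.
Proof.
move=> ps; have H x : strd s x -> strd s' x /\ nth false s x = nth false s' x.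
  case/prefixP: ps => r ->; rewrite /strd size_cat nth_cat => lx.
  by rewrite lx ltn_addr.
move=> /(halted_mono H); rewrite /hlt -(subnK (size_prefix ps)) iterD => h.
by rewrite iter_mstep_halted.
Qed.

Lemma jumpP X e : reflect (exists y, eval X (program e) [:: e] y) (jump X e).
Proof.
by rewrite /jump /asbool; case: excluded_middle_informative => h; constructor.
Qed.

Lemma jump_hlt X e : jump X e <-> exists m, hlt (mkseq X m) e.
Proof.
split.
  move=> /jumpP/eval_halted[k Hk].
  have [m0 Hm0] := finite_use X (running (program e) [:: e] [::]) k.
  (* The prefix must be at least as long as the running time [k] and the use [m0]. *)
  exists (maxn k m0); rewrite /hlt size_mkseq.
  rewrite -[in iter (maxn _ _) _ _](subnK (leq_maxl k m0)) iterD.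
  rewrite (Hm0 _ _ _ (leq_maxr k m0)); first by rewrite (iter_mstep_halted _ _ _ Hk).
  by move=> x lx; rewrite /strd size_mkseq subnK ?leq_maxl // nth_mkseq.
move=> [m Hm]; apply/jumpP/eval_halted; exists m; move: Hm; rewrite /hlt size_mkseq.
apply: halted_mono => x; rewrite /strd size_mkseq => lx.
by rewrite nth_mkseq.
Qed.

(** * Computability of the numbering of programs *)

Lemma unpickle_prf e :
  unpickle e = obind prf_dec (GenTree.decode (pmap unpickle (CodeSeq.decode e))) :> option prf.
Proof. by []. Qed.

Lemma unpickle_sum n : unpickle n = (if CodeSeq.decode n is [:: a; b] then
   sum_of_opair (ohead (CodeSeq.decode a), ohead (CodeSeq.decode b)) else None)
   :> option (nat + nat).
Proof.
have E m : unpickle m = Some (ohead (CodeSeq.decode m)) :> option (option nat).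
  rewrite /unpickle /= /pcomp /= /unpickle_seq; congr (Some (ohead _)).
  by elim: (CodeSeq.decode m) => //= x l ->.
have -> : unpickle n = obind (@sum_of_opair nat nat) (omap (@pair_of_tag _ _)
    (@unpickle_tagged (option nat) (fun=> option nat) n)) by [].
rewrite /unpickle_tagged.
by case: (CodeSeq.decode n) => [|a [|b [|c l]]]; rewrite ?E.
Qed.

(* The image of a tree under decoding: (is a leaf, leaf label, decodes to a
   program, that program). *)
Local Notation item := (bool * nat * bool * prf)%type.
Definition tree_item (t : GenTree.tree nat) : item :=
  match t with
  | GenTree.Leaf x => (true, x, false, PZero)
  | _ => if prf_dec t is Some p then (false, 0, true, p) else (false, 0, false, PZero)
  end.

(** The action of [prf_dec] at a single node, computed from the items of the children; the labels
    are those of [prf_enc]. *)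
Definition node_item n (fs : seq item) : item :=
  let d : item := (false, 0, false, PZero) in
  let ok b p : item := (false, 0, b, if b then p else PZero) in
  if n == 0 then ok (nilp fs) PZero
  else if n == 1 then ok (nilp fs) PSucc
  else if n == 2 then ok ((size fs == 1) && (head d fs).1.1.1) (PProj (head d fs).1.1.2)
  else if n == 3 then ok (nilp fs) POracle
  else if n == 4 then ok (~~ nilp fs && all (fun f : item => f.1.2) fs)
     (PComp (head d fs).2 (map (fun f : item => f.2) (behead fs)))
  else if n == 5 then ok ((size fs == 2) && all (fun f : item => f.1.2) fs)
     (PRec (head d fs).2 (head d (behead fs)).2)
  else if n == 6 then ok ((size fs == 1) && all (fun f : item => f.1.2) fs)
     (PMu (head d fs).2)
  else d.

Lemma tree_item_dec t : prf_dec t = if (tree_item t).1.2 then Some (tree_item t).2 else None.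
Proof. by case: t => [x|n fs] //; rewrite /tree_item; case: (prf_dec _). Qed.

Definition prf_decs := fix decs (ts : seq (GenTree.tree nat)) : option (seq prf) :=
  match ts with
  | [::] => Some [::]
  | t :: ts => match prf_dec t, decs ts with
               | Some p, Some ps => Some (p :: ps)
               | _, _ => None
               end
  end.

Lemma tree_item_node n fs : tree_item (GenTree.Node n fs) = node_item n (map tree_item fs).
Proof.
case: n => [|[|[|[|[|[|[|n]]]]]]].
- by case: fs.
- by case: fs.
- case: fs => [|[x|m gs] [|f fs]] //=; rewrite /node_item /=.
  by case: (match m with 0 => _ | _ => _ end).
- by case: fs.
- case: fs => [|f fs] //; rewrite [LHS]/= (tree_item_dec f) /node_item /=.
  case: (tree_item f).1.2 => //=.
  suff E : prf_decs fs = if all (fun f : item => f.1.2) (map tree_item fs) then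
      Some (map (fun f : item => f.2) (map tree_item fs)) else None.
    by rewrite -/(prf_decs fs) E; case: (all _ _).
  elim: fs => //= t ts ->; rewrite (tree_item_dec t).
  by case: (tree_item t).1.2 => //=; case: (all _ _).
- case: fs => [|f [|g [|h fs]]] //.
  rewrite [LHS]/= (tree_item_dec f) (tree_item_dec g) /node_item /=.
  by case: (tree_item f).1.2 => //; case: (tree_item g).1.2.
- case: fs => [|f [|g fs]] //; rewrite [LHS]/= (tree_item_dec f) /node_item /=.
  by case: (tree_item f).1.2.
- by [].
Qed.

(** The stack algorithm of [GenTree.decode], run on items so that no trees need to be coded. The
    symbol [inl 0] starts a new list of children, and [inl n.+1] completes a node labelled [n]. *)
Definition decode_item (n : nat) (acc : seq item * seq (seq item)) : seq item * seq (seq item) :=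
  let d := CodeSeq.decode n in
  let a := CodeSeq.decode (head 0 d) in
  let b := CodeSeq.decode (head 0 (behead d)) in
  if size d == 2 then
    if ~~ nilp b then ((true, head 0 b, false, PZero) :: acc.1, acc.2)
    else if ~~ nilp a then
      (if head 0 a == 0 then ([::], acc.1 :: acc.2)
       else (node_item (head 0 a).-1 acc.1 :: head [::] acc.2, behead acc.2))
    else acc
  else acc.

Definition program_item (e : nat) : item :=
  head (false, 0, false, PZero) (foldr decode_item ([::], [::]) (CodeSeq.decode e)).1.

Lemma programE e :
  program e = if (program_item e).1.2 then (program_item e).2 else PMu PSucc.
Proof.
rewrite /program unpickle_prf /GenTree.decode /program_item.
(* Decoding commutes with [phi], the passage from trees to items. *)
pose phi (fs : seq (GenTree.tree nat) * seq (seq (GenTree.tree nat))) :=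
  (map tree_item fs.1, map (map tree_item) fs.2).
set F := foldr _ _ (pmap _ _); have -> : foldr decode_item ([::], [::]) (CodeSeq.decode e) = phi F.
  rewrite /F; elim: (CodeSeq.decode e) => [|n l IH] //=; rewrite IH unpickle_sum /decode_item.
  case: (CodeSeq.decode n) => [|a [|b [|]]] //=.
  case: (CodeSeq.decode b) => [|y b'] //=; case: (CodeSeq.decode a) => [|x a'] //=.
  case: x => [|x] //=; rewrite -tree_item_node.
  by set fs := foldr _ _ _; rewrite /phi /=; case: (fs.2).
by case: F => [[|t ts] us] //=; rewrite tree_item_dec; case: ifP.
Qed.

Lemma ucomp_program {I} {O : I -> nat -> bool} {A} {eA : encodable A} (f : I -> A -> nat) :
  ucomp O f -> ucomp O (fun i a => program (f i a)).
Proof.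
move=> Hf; apply: (@ucomp_ext _ _ _ _ _ _ (fun i a =>
  if (program_item (f i a)).1.2 then (program_item (f i a)).2 else PMu PSucc)).
  by move=> i a; rewrite programE.
have Hn : ucomp O (fun i (p : nat * seq item) => node_item p.1 p.2).
  by rewrite /node_item; uc.
have Hd : ucomp O (fun i (p : nat * (seq item * seq (seq item))) => decode_item p.1 p.2).
  by rewrite /decode_item; move: node_item Hn => nd Hn; uc.
have Hp : ucomp O (fun i n => program_item n) 
  by rewrite /program_item; move: decode_item Hd => dc Hd; uc.
by move: program_item Hp => pit Hp; uc.
Qed.

Definition smstep (s : seq bool) := mstep (strd s) (nth false s).

Lemma ucomp_hlt {I} {O : I -> nat -> bool} {A} {eA : encodable A}
    (f : I -> A -> seq bool) (g : I -> A -> nat) :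
  ucomp O f -> ucomp O g -> ucomp O (fun i a => hlt (f i a) (g i a)).
Proof.
move=> Hf Hg.
have Hs : ucomp O (fun i q => smstep q.1 q.2).
  by rewrite /smstep /mstep /running /returning /strd; cbv zeta; uc.
have Hr : ucomp O (fun i q => running (program q) [:: q] [::]).
  by rewrite /running; uc; apply: ucomp_program; uc.
have : ucomp O (fun i a => iter (size (f i a)) (smstep (f i a))
   (running (program (g i a)) [:: g i a] [::])).
  apply: ucomp_iter; first by uc.
    by apply: (ucomp_comp2 (h := fun=> smstep)); uc.
  exact: (ucomp_comp Hr Hg).
move=> H; exact: (ucomp_and (ucomp_neg (ucomp_fst (ucomp_fst (ucomp_fst H))))
  (ucomp_nilp (ucomp_snd H))).
Qed.
Global Opaque hlt.

(** * Jumps and the low basis theorem *)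

Lemma asboolP (P : Prop) : reflect P (asbool P).
Proof. by rewrite /asbool; case: excluded_middle_informative => h; constructor. Qed.

Lemma ucomp_mkseq {I} {O : I -> nat -> bool} {A B} {eA : encodable A} {eB : encodable B}
    (f : I -> A -> nat -> B) (n : I -> A -> nat) :
  ucomp O (fun i p => f i p.1 p.2) -> ucomp O n -> ucomp O (fun i a => mkseq (f i a) (n i a)).
Proof. by move=> Hf Hn; rewrite /mkseq; uc. Qed.

Ltac uc_hlt :=
  lazymatch goal with
  | |- ucomp _ (fun i a => mkseq (@?f i a) (@?g i a)) => apply: ucomp_mkseq
  | |- ucomp _ (fun i a => hlt (@?f i a) (@?g i a)) => apply: ucomp_hlt
  | |- _ => uc_prf
  end.
Ltac uc_ext ::= uc_hlt.

Notation rcomp X f := (ucomp (fun _ : unit => X) (fun _ => f)).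

Lemma Tle_rcomp A X : Tle A X <-> rcomp X A.
Proof.
split=> [[p Hp]|[p Hp]]; exists p.
  by move=> i x; have := Hp x; rewrite /enc /=; case: (A x).
by move=> x; have := Hp tt x; rewrite /enc /=; case: (A x).
Qed.

Lemma rcomp_lift {J} (O : J -> nat -> bool) (X : nat -> bool) {A B} {eA : encodable A}
    {eB : encodable B} (f : A -> B) :
  ucomp O (fun _ => X) -> rcomp X f -> ucomp O (fun _ => f).
Proof. exact: (@ucomp_lift _ _ (fun _ : unit => X) O (fun=> tt)). Qed.

Lemma Tle_refl X : Tle X X.
Proof. by apply/Tle_rcomp; apply: ucomp_oracle; uc. Qed.

Lemma Tle_trans A B D : Tle A B -> Tle B D -> Tle A D.
Proof.
move=> /Tle_rcomp HA /Tle_rcomp HB; apply/Tle_rcomp; exact: rcomp_lift HB HA.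
Qed.

(** * The s-m-n theorem, enumerable relations and Post's theorem *)

Fixpoint pconst a := if a is a'.+1 then PComp PSucc [:: pconst a'] else PZero.

Lemma eval_pconst X a v : eval X (pconst a) v a.
Proof.
elim: a => [|a IH] /=; first by constructor.
by econstructor; [econstructor; [exact: IH|constructor]|constructor].
Qed.

(** The index [f a] names a program that discards its input and runs [p] on the constant [a]: the
    jump feeds a program its own index, which must not influence the result. *)
Lemma smn p : exists2 f : nat -> nat,
  (forall I (O : I -> nat -> bool), ucomp O (fun _ => f)) &
  forall X a, jump X (f a) <-> exists y, eval X p [:: a] y.
Proof.
exists (fun a => pickle (PComp p [:: pconst a])); last first.
  move=> X a; set e := pickle _.
  have pe : program e = PComp p [:: pconst a] by rewrite /program pickleK.
  split=> [/jumpP[y]|[y Hy]]; last first.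
    apply/jumpP; exists y; rewrite pe; econstructor; last exact: Hy.
    by constructor; [exact: eval_pconst|constructor].
  rewrite pe => H; inversion H as [| | | |? ? ? ws ? Hgs Hf| | |]; subst.
  exists y; inversion Hgs as [|? ? ? z zs Hz Hzs]; subst.
  by rewrite (eval_det Hz (eval_pconst X a [:: e])) in Hf; inversion Hzs; subst.
(* In a serialised tree a composition is opened by [inl 5], its label 4 shifted by one, and closed
   by [inl 0]. So the code of [pconst a] is an [a]-fold wrapping, computable by iteration. *)
pose sym (p : prf) := map pickle (GenTree.encode (prf_enc p)).
have Ep q : pickle q = CodeSeq.code (sym q) by [].
pose wrap l r m : seq nat := l ++ m ++ r.
have sC q a : sym (PComp q [:: pconst a]) =
    wrap (pickle (inl 5 : nat + nat) :: sym q) [:: pickle (inl 0 : nat + nat)] (sym (pconst a)).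
  by rewrite /sym /wrap /= cats0 map_rcons map_cat -cats1 catA.
have sK a : sym (pconst a) = iter a (wrap (pickle (inl 5 : nat + nat) :: sym PSucc)
   [:: pickle (inl 0 : nat + nat)]) (sym PZero).
  by elim: a => // a IH; rewrite [pconst _.+1]/= sC IH.
move=> I O; apply: (@ucomp_ext _ _ _ _ _ _ (fun _ a => CodeSeq.code (
  (pickle (inl 5 : nat + nat) :: sym p) ++ iter a (fun m =>
    (pickle (inl 5 : nat + nat) :: sym PSucc) ++ m ++ [:: pickle (inl 0 : nat + nat)])
    (sym PZero) ++ [:: pickle (inl 0 : nat + nat)]))).
  by move=> _ a; rewrite Ep sC sK.
move: (pickle _ :: sym p) (pickle _ :: sym PSucc) (sym PZero) [:: pickle _] => l1 l2 l3 l4.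
by uc.
Qed.

Section SemiDecidable.
Context {I : Type} {O : I -> nat -> bool} {A : Type} {eA : encodable A}.

Lemma uce_program (R : I -> A -> Prop) : uce O R ->
  exists p, forall i a, R i a <-> exists y, eval (O i) p [:: enc a] y.
Proof.
move=> [P HP HR].
have [p Hp] : ucomp O (fun i (q : A * nat) => ~~ P i q.1 q.2) by uc.
have [u Hu] := rawcomp_npair (rawcomp_nth 2 1) (rawcomp_nth 2 0).
have E i a n : eval (O i) (PComp p [:: u]) [:: n; enc a] (~~ P i a n).
  apply: (@ev_comp _ _ _ _ [:: enc (a, n)]); last exact: Hp.
  by econstructor; [exact: Hu|constructor].
exists (PMu (PComp p [:: u])) => i a; rewrite HR; split.
  move=> ex; exists (ex_minn ex); case: ex_minnP => n Pn nmin; constructor.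
    by have := E i a n; rewrite Pn.
  move=> m lm; exists 0; have := E i a m; case: (boolP (P i a m)) => // Pm.
  by move: (nmin _ Pm); rewrite leqNgt lm.
move=> [n H]; inversion H as [| | | | | | |? ? ? H0 Hm]; subst; exists n.
by have := eval_det H0 (E i a n); case: (P i a n).
Qed.

Lemma uce_jump (R : I -> A -> Prop) : uce O R ->
  exists2 f : nat -> nat, (forall J (O' : J -> nat -> bool), ucomp O' (fun _ => f)) &
    forall i a, R i a <-> jump (O i) (f (enc a)).
Proof.
move=> /uce_program[p Hp]; have [f Hf Ef] := smn p.
by exists f => // i a; rewrite Hp Ef.
Qed.

Lemma uce_comp {B} {eB : encodable B} (R : I -> B -> Prop) (f : I -> A -> B) :
  uce O R -> ucomp O f -> uce O (fun i a => R i (f i a)).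
Proof.
move=> [P HP HR] Hf; exists (fun i a => P i (f i a)); last by move=> i a; rewrite HR.
exact: (@ucomp_comp _ _ _ _ _ _ _ _ (fun i q => P i q.1 q.2)
   (fun i q => (f i q.1, q.2)) HP (ltac:(by uc))).
Qed.

Lemma ucomp_uce (P : I -> A -> bool) : ucomp O P -> uce O P.
Proof.
move=> HP; exists (fun i a _ => P i a); first by uc.
by move=> i a; split=> [h|[]//]; exists 0.
Qed.

Lemma uce_ext (R R' : I -> A -> Prop) : (forall i a, R i a <-> R' i a) -> uce O R -> uce O R'.
Proof. by move=> e [P HP HR]; exists P => // i a; rewrite -e HR. Qed.

Lemma uce_ex {B} {eB : encodable B} (R : I -> A -> B -> Prop) :
  ucomp O (fun _ (n : nat) => dec n : B) ->
  uce O (fun i p => R i p.1 p.2) -> uce O (fun i a => exists b, R i a b).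
Proof.
move=> Hd [P HP HR].
exists (fun i a n => P i (a, dec (dec n : nat * nat).1) (dec n : nat * nat).2).
  apply: (@ucomp_comp _ _ _ _ _ _ _ _ (fun i q => P i q.1 q.2) (fun i (q : A * nat) =>
    ((q.1, dec (dec q.2 : nat * nat).1), (dec q.2 : nat * nat).2)) HP).
  by uc.
move=> i a; split=> [[b /(HR i (a, b))[n Hn]]|[n Hn]].
  by exists (enc (enc b, n)); rewrite !encK.
exists (dec (dec n : nat * nat).1).
by apply/(HR i (a, _)); exists (dec n : nat * nat).2.
Qed.

Lemma uce_and (R R' : I -> A -> Prop) :
  uce O R -> uce O R' -> uce O (fun i a => R i a /\ R' i a).
Proof.
move=> [P HP HR] [P' HP' HR'].
exists (fun i a n => P i a (dec n : nat * nat).1 && P' i a (dec n : nat * nat).2).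
  by uc.
move=> i a; rewrite HR HR'; split=> [[[n Hn] [m Hm]]|[n /andP[H1 H2]]].
  by exists (enc (n, m)); rewrite encK Hn Hm.
by split; eexists; eassumption.
Qed.

Lemma uce_or (R R' : I -> A -> Prop) :
  uce O R -> uce O R' -> uce O (fun i a => R i a \/ R' i a).
Proof.
move=> [P HP HR] [P' HP' HR'].
exists (fun i a n => P i a n || P' i a n); first by uc.
move=> i a; rewrite HR HR'; split=> [[[n Hn]|[n Hn]]|[n /orP[H|H]]].
- by exists n; rewrite Hn.
- by exists n; rewrite Hn orbT.
- by left; exists n.
- by right; exists n.
Qed.

(** Finitely many witnesses have a common bound, and this bound serves as the single witness. *)
Lemma uce_forall_lt (R : I -> A -> nat -> Prop) (b : I -> A -> nat) :
  uce O (fun i p => R i p.1 p.2) -> ucomp O b ->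
  uce O (fun i a => forall k, k < b i a -> R i a k).
Proof.
move=> [P HP HR] Hb.
exists (fun i a n => all (fun k => has (fun m => P i (a, k) m) (iota 0 n)) (iota 0 (b i a))).
  uc; apply: (@ucomp_comp _ _ _ _ _ _ _ _ (fun i q => P i q.1 q.2)
    (fun i q => ((q.1.1.1, q.1.2), q.2)) HP); by uc.
move=> i a; split=> [H|[n /allP H] k lk]; last first.
  by have /hasP[m _ Pm] := H k (ltac:(by rewrite mem_iota)); apply/(HR i (a, k)); exists m.
have {}H k : exists n, k < b i a -> P i (a, k) n.
  case: (boolP (k < b i a)) => [lk|_]; last by exists 0.
  by have [n Hn] := (HR i (a, k)).1 (H k lk); exists n.
elim: (b i a) H => [|m IH] H; first by exists 0.
have [k|n Hn] := IH; first by have [n Hn] := H k; exists n => lk; apply: Hn; apply: ltnW.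
have [n' Hn'] := H m; exists (maxn n n'.+1); apply/allP => k; rewrite mem_iota add0n /= ltnS.
rewrite leq_eqVlt => /predU1P[->|lk].
  by apply/hasP; exists n'; rewrite ?Hn' // mem_iota leq_max leqnn orbT.
have /hasP[m' lm Pm] := allP Hn k (ltac:(by rewrite mem_iota)); apply/hasP; exists m' => //.
by rewrite mem_iota leq_max; move: lm; rewrite mem_iota => /= ->.
Qed.

End SemiDecidable.

Lemma uce_lift {I J} (O : I -> nat -> bool) (O' : J -> nat -> bool) (h : J -> I)
    {A} {eA : encodable A} (R : I -> A -> Prop) :
  ucomp O' (fun j x => O (h j) x) -> uce O R -> uce O' (fun j a => R (h j) a).
Proof.
move=> HO [P HP HR]; exists (fun j => P (h j)); last by move=> j a; rewrite HR.
exact: (ucomp_lift HO HP).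
Qed.

Notation rce X R := (uce (fun _ : unit => X) (fun _ => R)).

Lemma rce_lift {J} (O : J -> nat -> bool) (X : nat -> bool) {A} {eA : encodable A}
    (R : A -> Prop) :
  ucomp O (fun _ => X) -> rce X R -> uce O (fun _ => R).
Proof. exact: (@uce_lift _ _ (fun _ : unit => X) O (fun=> tt)). Qed.

Lemma uce_jumps {I} (O : I -> nat -> bool) : uce O (fun i e => jump (O i) e).
Proof.
exists (fun i e m => hlt (mkseq (O i) m) e); last by move=> i e; apply: jump_hlt.
by uc.
Qed.

Lemma rce_rcomp_jump X A (eA : encodable A) (R : A -> Prop) :
  rce X R -> rcomp (jump X) (fun a => asbool (R a)).
Proof.
move=> /uce_jump[f Hf E].
apply: (@ucomp_ext _ _ _ _ _ _ (fun _ a => jump X (f (enc a)))).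
  by move=> [] a; apply/idP/asboolP => /E; apply.
by apply: ucomp_oracle; apply: (ucomp_comp (Hf _ _)); uc.
Qed.

Lemma Tle_jump X : Tle X (jump X).
Proof.
apply/Tle_rcomp; apply: (@ucomp_ext _ _ _ _ _ _ (fun _ a => asbool (X a))).
  by move=> _ a; apply/asboolP/idP.
apply: rce_rcomp_jump; apply: ucomp_uce; apply/Tle_rcomp; exact: Tle_refl.
Qed.

Lemma jump_mono A X : Tle A X -> Tle (jump A) (jump X).
Proof.
move=> /Tle_rcomp HA; apply/Tle_rcomp.
apply: (@ucomp_ext _ _ _ _ _ _ (fun _ a => asbool (jump A a))).
  by move=> _ a; apply/asboolP/idP.
apply: rce_rcomp_jump; apply: (rce_lift HA).
exact: (@uce_jumps unit (fun=> A)).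
Qed.

(** Post's theorem: search both enumerations in parallel until one of them answers. *)
Lemma rcomp_post X A (eA : encodable A) (P : A -> bool) :
  rce X P -> rce X (fun a => ~~ P a) -> rcomp X P.
Proof.
move=> [P1 H1 E1] [P2 H2 E2].
have [|||f Hf Ef] := @ucomp_search _ (fun _ : unit => X) A eA nat nat_enc
  (fun i a n => P1 i a n || P2 i a n); [by uc|by uc| |].
  move=> i a; case: (boolP (P a)) => h; first by have [n Hn] := (E1 i a).1 h; exists n; rewrite Hn.
  by have [n Hn] := (E2 i a).1 h; exists n; rewrite Hn orbT.
apply: (@ucomp_ext _ _ _ _ _ _ (fun i a => P1 i a (f i a))); last by uc.
move=> i a; case/orP: (Ef i a) => h.
  by rewrite h; symmetry; apply/(E1 i a); exists (f i a).
have Pn : ~~ P a by apply/(E2 i a); exists (f i a).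
rewrite (negbTE Pn); apply/negP => h1; case/negP: Pn; apply/(E1 i a); by exists (f i a).
Qed.

(** * Joins of oracles, compactness and the low basis theorem *)

Definition join (Y Q : nat -> bool) n := if odd n then Q n./2 else Y n./2.

Lemma join_even Y Q n : join Y Q n.*2 = Y n.
Proof. by rewrite /join odd_double doubleK. Qed.
Lemma join_odd Y Q n : join Y Q n.*2.+1 = Q n.
Proof. by rewrite /join /= odd_double /= uphalf_double. Qed.

Lemma ucomp_join_l Q A (eA : encodable A) (f : (nat -> bool) -> A -> nat) :
  ucomp (join^~ Q) f -> ucomp (join^~ Q) (fun Y a => Y (f Y a)).
Proof.
move=> Hf; apply: (@ucomp_ext _ _ _ _ _ _ (fun Y a => join Y Q (f Y a).*2)).
  by move=> Y a; rewrite join_even.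
by apply: ucomp_oracle; uc.
Qed.

Lemma ucomp_join_r Q : ucomp (join^~ Q) (fun _ => Q).
Proof.
apply: (@ucomp_ext _ _ _ _ _ _ (fun Y a => join Y Q a.*2.+1)).
  by move=> Y a; rewrite join_odd.
by apply: ucomp_oracle; uc.
Qed.

Lemma Tle_join_l Y Q : Tle Y (join Y Q).
Proof.
apply/Tle_rcomp; apply: (@ucomp_ext _ _ _ _ _ _ (fun _ a => join Y Q a.*2)).
  by move=> _ a; rewrite join_even.
by apply: ucomp_oracle; uc.
Qed.

Lemma Tle_join_r Y Q : Tle Q (join Y Q).
Proof.
apply/Tle_rcomp; apply: (@ucomp_ext _ _ _ _ _ _ (fun _ a => join Y Q a.*2.+1)).
  by move=> _ a; rewrite join_odd.
by apply: ucomp_oracle; uc.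
Qed.

Lemma prefix_mkseq (Y : nat -> bool) m n : m <= n -> prefix (mkseq Y m) (mkseq Y n).
Proof.
move=> lmn; apply/prefixP; exists (map Y (iota m (n - m))).
by rewrite /mkseq -map_cat -{3}[m]add0n -iotaD subnKC.
Qed.

Lemma mkseq_nth_eq (Y Y' : nat -> bool) n :
  (forall x, x < n -> Y x = Y' x) -> mkseq Y n = mkseq Y' n.
Proof.
by move=> e; apply/eq_in_map => x; rewrite mem_iota => /andP[_ lx]; apply: e.
Qed.

(** Compactness of Cantor space for a decreasing sequence of nonempty clopen classes. The path runs
    through strings that extend to a member of every [P m], turning to [false] whenever possible. *)
Lemma compactness (P : nat -> (nat -> bool) -> Prop) :
  (forall m Y, P m.+1 Y -> P m Y) ->
  (forall m, exists b, forall Y Y', (forall x, x < b -> Y x = Y' x) -> P m Y -> P m Y') ->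
  (forall m, exists Y, P m Y) -> exists Y, forall m, P m Y.
Proof.
move=> Pdec Puse Psat.
have {}Pdec m n Y : m <= n -> P n Y -> P m Y.
  by elim: n => [|n IH]; [rewrite leqn0 => /eqP ->|rewrite leq_eqVlt => /predU1P[->//|/IH h /Pdec]].
pose G s := forall m, exists2 Y, mkseq Y (size s) = s & P m Y.
have Gstep s : G s -> G (rcons s false) \/ G (rcons s true).
  move=> Gs; apply: NNPP => /not_or_and[/not_all_ex_not[m0 H0] /not_all_ex_not[m1 H1]].
  have [Y Ys PY] := Gs (maxn m0 m1).
  case e : (Y (size s)).
    case: H1; exists Y; last exact: (Pdec _ _ _ (leq_maxr _ _) PY).
    by rewrite size_rcons mkseqS Ys e.
  case: H0; exists Y; last exact: (Pdec _ _ _ (leq_maxl _ _) PY).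
  by rewrite size_rcons mkseqS Ys e.
pose nxt s := if asbool (G (rcons s false)) then rcons s false else rcons s true.
pose sg n := iter n nxt [::].
have Gsg n : G (sg n).
  elim: n => [|n IH]; first by move=> m; have [Y PY] := Psat m; exists Y.
  by rewrite /sg /= -/(sg n) /nxt; case: asboolP => // h; case: (Gstep _ IH).
have size_sg n : size (sg n) = n.
  by elim: n => //= n IH; rewrite /nxt; case: asboolP => _; rewrite size_rcons IH.
pose Y x := nth false (sg x.+1) x.
have Ysg n : mkseq Y n = sg n.
  elim: n => //= n IH; rewrite mkseqS IH.
  have : exists b, sg n.+1 = rcons (sg n) b.
    by rewrite /sg /= /nxt; case: asboolP => _; eexists.
  by move=> [b e]; rewrite /Y e nth_rcons size_sg ltnn eqxx.
exists Y => m; have [b Hb] := Puse m; have [Y' e PY'] := Gsg b m.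
apply: Hb PY' => x lx; rewrite size_sg -Ysg in e.
by have := congr1 (nth false ^~ x) e; rewrite /= !nth_mkseq.
Qed.

Fixpoint bstrings m : seq (seq bool) :=
  if m is m'.+1 then map (cons false) (bstrings m') ++ map (cons true) (bstrings m')
  else [:: [::]].

Lemma mem_bstrings m s : (s \in bstrings m) = (size s == m).
Proof.
elim: m s => [|m IH] [|b s] //=; rewrite mem_cat.
  by apply/negbTE; rewrite negb_or; apply/andP; split; apply/mapP => -[].
have E c : (b :: s \in map (cons c) (bstrings m)) = (b == c) && (size s == m).
  rewrite -IH; apply/mapP/andP => [[t Ht [-> ->]]|[/eqP -> Hs]]; first by rewrite eqxx.
  by exists s.
by rewrite !E eqSS; case: (b) => /=; rewrite ?orbF.
Qed.

Lemma ucomp_bstrings {I} {O : I -> nat -> bool} {A} {eA : encodable A} (f : I -> A -> nat) :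
  ucomp O f -> ucomp O (fun i a => bstrings (f i a)).
Proof.
move=> Hf; apply: (@ucomp_ext _ _ _ _ _ _ (fun i a =>
  iter (f i a) (fun l => map (cons false) l ++ map (cons true) l) [:: [::]])).
  by move=> i a; elim: (f i a) => //= n ->.
by uc.
Qed.

Section LowBasis.
Variables (Q : nat -> bool) (e0 : nat).

(** The Pi_1(Q) class in question consists of the [Y] that keep [e0] out of the jump of [join Y Q].
    A string [s] is a prefix of [Y], and [jstr s] is the prefix of the join that it determines. By
    compactness, [dead d] says that no [Y] keeps all members of [d] out of that jump, yet it is
    Sigma_1 in [Q]. *)
Let jstr (s : seq bool) := mkseq (join (nth false s) Q) (size s).*2.
Let good (d : seq nat) s := ~~ has (hlt (jstr s)) d.
Let dead d := asbool (exists m, all (fun s => ~~ good d s) (bstrings m)).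

Lemma join_stringE Y k : jstr (mkseq Y k) = mkseq (join Y Q) k.*2.
Proof.
rewrite /jstr size_mkseq; apply: mkseq_nth_eq => x lx; rewrite /join; case: (odd x) => //.
rewrite nth_mkseq // -ltn_double; apply: leq_ltn_trans lx.
by rewrite -[leqRHS]odd_double_half leq_addl.
Qed.

Lemma join_string_mono Y m n : m <= n ->
  prefix (jstr (mkseq Y m)) (jstr (mkseq Y n)).
Proof. by move=> lmn; rewrite !join_stringE; apply: prefix_mkseq; rewrite leq_double. Qed.

Lemma jump_join_string Y i : jump (join Y Q) i <-> exists m, hlt (jstr (mkseq Y m)) i.
Proof.
rewrite jump_hlt; split=> [[m Hm]|[m]]; last by rewrite join_stringE; exists m.*2.
exists m; rewrite join_stringE; apply: hlt_mono Hm; apply: prefix_mkseq.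
by rewrite -addnn leq_addl.
Qed.

Lemma rcomp_dead : rcomp (jump Q) dead.
Proof.
rewrite /dead; apply: rce_rcomp_jump; apply: uce_ex; first by uc.
apply: ucomp_uce; rewrite /good /jstr /join.
have HQ : rcomp Q Q by apply/Tle_rcomp; apply: Tle_refl.
uc; apply: ucomp_bstrings; uc.
Qed.

(* Force each [i] in turn out of the jump of [join Y Q] whenever the resulting
   class of [Y] stays nonempty; whether it does is a question to [jump Q]. *)
Lemma low_basis : (exists Y, ~~ jump (join Y Q) e0) ->
  exists2 Y, ~~ jump (join Y Q) e0 & Tle (jump (join Y Q)) (jump Q).
Proof.
move=> [Y0 HY0].
pose st (s : nat * seq nat) := (s.1.+1, if dead (s.1 :: s.2) then s.2 else s.1 :: s.2).
(* [D i] lists [e0] and those indices below [i] that could be kept out of the jump. *)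
pose D i := (iter i st (0, [:: e0])).2.
have D1 i : (iter i st (0, [:: e0])).1 = i by elim: i => //= i ->.
have DS i : D i.+1 = if dead (i :: D i) then D i else i :: D i.
  by rewrite /D iterS {1}/st D1.
have Ddead i : ~~ dead (D i).
  elim: i => [|i IH]; last by rewrite DS; case: ifP => // /negbT.
  apply/negP => /asboolP[m /allP H].
  have := H (mkseq Y0 m); rewrite mem_bstrings size_mkseq eqxx negbK /= orbF => /(_ isT) h.
  by case/negP: HY0; apply/jump_join_string; exists m.
have Dsub i j s : i <= j -> good (D j) s -> good (D i) s.
  elim: j => [|j IH]; first by rewrite leqn0 => /eqP ->.
  rewrite leq_eqVlt => /predU1P[-> //|lij]; rewrite DS; case: ifP => _ h; apply: IH => //.
  by move: h; rewrite /good /= negb_or => /andP[].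
have good_mono d Y m n : m <= n -> good d (mkseq Y n) -> good d (mkseq Y m).
  move=> lmn; apply: contra => /hasP[i id hi]; apply/hasP; exists i => //.
  exact: hlt_mono (join_string_mono Y lmn) hi.
have [Y HY] : exists Y, forall m, good (D m) (mkseq Y m).
  apply: compactness => [m Y h|m|m].
  - by apply: (good_mono _ _ _ _ (leqnSn m)); apply: Dsub h.
  - by exists m => Y Y' eY; rewrite (mkseq_nth_eq eY).
  - have : ~~ all (fun s => ~~ good (D m) s) (bstrings m).
      by apply: contra (Ddead m) => h; apply/asboolP; exists m.
    case/allPn => s; rewrite mem_bstrings negbK => /eqP <- gs.
    by exists (nth false s); rewrite mkseq_nth.
have {}HY i m : good (D i) (mkseq Y m).
  apply: good_mono (leq_maxl m i) _; apply: Dsub (leq_maxr m i) _; exact: HY.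
exists Y.
  apply/negP => /jump_join_string[m Hm].
  by have := HY 0 m; rewrite /good /= Hm.
(* An index enters the jump exactly when keeping it out was impossible at its stage, and [jump Q]
   decides this. *)
have JE i : jump (join Y Q) i = dead (i :: D i).
  apply/idP/idP => [/jump_join_string[m Hm]|/asboolP[m /allP H]].
    apply: contraT => nd; have := HY i.+1 m; rewrite DS (negbTE nd).
    by rewrite /good /= Hm.
  apply/jump_join_string; exists m.
  have := H (mkseq Y m); rewrite mem_bstrings size_mkseq eqxx negbK => /(_ isT) /=.
  by case/orP => // h; have := HY i m; rewrite /good h.
apply/Tle_rcomp; apply: (@ucomp_ext _ _ _ _ _ _ (fun _ i => dead (i :: D i))).
  by move=> _ i; rewrite JE.
by have Hd := rcomp_dead; rewrite /D /st; uc.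
Qed.

End LowBasis.

(** * Requirements, covers and the splitting tree *)

Local Notation cond := (seq bool * nat)%type.

Definition ext (Y : nat -> bool) (s t : seq bool) :=
  (take (size s) t == s) &&
  all (fun x => [|| x < size s, ~~ nth false t x | Y x]) (iota 0 (size t)).

Lemma extP (Y : nat -> bool) s t : reflect (prefix s t /\
  forall x, size s <= x < size t -> nth false t x -> Y x) (ext Y s t).
Proof.
rewrite /ext -prefixE; apply: (iffP andP) => -[ps H]; split=> //.
  move=> x /andP[sx xt] tx; have /allP/(_ x) := H; rewrite mem_iota add0n xt ltnNge sx tx.
  by apply.
apply/allP => x; rewrite mem_iota add0n /= => xt; case: ltnP => //= sx.
by case tx : (nth false t x) => //=; apply: H; rewrite ?sx.
Qed.

Lemma ext_refl Y s : ext Y s s.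
Proof. by apply/extP; split=> [|x]; [exact: prefix_refl|case: ltnP => // sx; rewrite leqNgt sx]. Qed.

Lemma ext_sub (Y Y' : nat -> bool) s t : (forall x, Y x -> Y' x) -> ext Y s t -> ext Y' s t.
Proof. by move=> h /extP[ps H]; apply/extP; split=> // x /H h' /h' /h. Qed.

Lemma ext_trans Y s t u : ext Y s t -> ext Y t u -> ext Y s u.
Proof.
move=> /extP[ps Hs] /extP[pt Ht]; apply/extP; split; first exact: prefix_trans pt.
move=> x /andP[sx xu] ux; case: (ltnP x (size t)) => xt; last by apply: Ht => //; rewrite xt.
apply: Hs; first by rewrite sx.
by move: ux; case/prefixP: pt => r ->; rewrite nth_cat xt.
Qed.

Lemma ext_local (Y Y' : nat -> bool) s t :
  (forall x, x < size t -> Y x = Y' x) -> ext Y s t = ext Y' s t.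
Proof.
move=> e; congr (_ && _); apply: eq_in_all => x; rewrite mem_iota add0n /= => xt.
by rewrite e.
Qed.

Lemma ucomp_ext_string {I} {O : I -> nat -> bool} {A} {eA : encodable A}
    (Y : I -> A -> nat -> bool) (s t : I -> A -> seq bool) :
  ucomp O (fun i p => Y i p.1 p.2) -> ucomp O s -> ucomp O t ->
  ucomp O (fun i a => ext (Y i a) (s i a) (t i a)).
Proof. by move=> HY Hs Ht; rewrite /ext; uc. Qed.

Definition forces_on (R : nat -> seq bool -> nat -> Prop) (c : seq bool * nat) (Y : nat -> bool) :=
  exists t u, ext Y c.1 t /\ R c.2 t u.

Lemma forces_on_sub R c (Y Y' : nat -> bool) :
  (forall x, Y x -> Y' x) -> forces_on R c Y -> forces_on R c Y'.
Proof. by move=> h [t [u [et Ru]]]; exists t, u; split=> //; apply: ext_sub et. Qed.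

(** The ideal generated by the sets that are not good and the sets disjoint from some [Xp s]. The
    sets outside it are the large ones; being large is partition regular. *)
Inductive small (good : (nat -> bool) -> Prop) (Xp : nat -> nat -> bool) : (nat -> bool) -> Prop :=
| small_bad (z : nat -> bool) : ~ good z -> small good Xp z
| small_tail (z : nat -> bool) s : (forall x, z x -> ~~ Xp s x) -> small good Xp z
| small_union (x y z : nat -> bool) : small good Xp x -> small good Xp y ->
    (forall n, z n -> x n || y n) -> small good Xp z.

Lemma small_bigunion good Xp r (Z : nat -> nat -> bool) (z : nat -> bool) :
  (forall i, i < r -> small good Xp (Z i)) ->
  (forall n, z n -> exists2 i, i < r & Z i n) -> small good Xp z.
Proof.
elim: r z => [|r IH] z HZ cov; first by apply: (@small_tail _ _ _ 0) => x /cov[].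
apply: (@small_union _ _ (fun n => z n && ~~ Z r n) (Z r)).
- apply: IH => [i li|n /andP[/cov[i li Zi] nZ]]; first by apply: HZ; apply: ltnW.
  move: li; rewrite ltnS leq_eqVlt => /predU1P[e|li]; last by exists i.
  by rewrite -e Zi in nZ.
- exact: HZ.
- by move=> n ->; case: (Z r n).
Qed.

Lemma size_decode n : size (CodeSeq.decode n) <= n.
Proof. by have := size_enc nat_enc (CodeSeq.decode n); rewrite /enc /= map_id CodeSeq.decodeK. Qed.

Section Covering.

Variable T : nat * seq bool * nat -> nat -> bool.

(** The number [x] codes a string, a stage and a witness accepted by [T]: a finite certificate that
    [Y] satisfies [c]. A string is no longer than its code, so only [Y] below [x] matters. *)
Definition meets (Y : nat -> bool) (c : cond) (x : nat) :=
  let q := dec x : seq bool * nat * nat in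
  ext Y c.1 q.1.1 && T (c.2, q.1.1, q.1.2) q.2.

Lemma meets_local Y Y' c x : (forall y, y < x -> Y y = Y' y) -> meets Y c x = meets Y' c x.
Proof.
move=> e; congr (_ && _); apply: ext_local => y ly; apply: e.
apply: leq_trans ly _; rewrite /= size_map; apply: leq_trans (size_decode _) _.
have nf z : nfst z <= z by rewrite -{2}(npairK z) leq_npair1.
exact: leq_trans (nf _) (nf _).
Qed.

Lemma meets_sub (Y Y' : nat -> bool) c x :
  (forall y, Y y -> Y' y) -> meets Y c x -> meets Y' c x.
Proof. by move=> h /andP[e t]; apply/andP; split=> //; apply: ext_sub e. Qed.

Lemma forces_on_meets R c Y : (forall q, R q.1.1 q.1.2 q.2 <-> exists w, T q w) ->
  forces_on R c Y <-> exists x, meets Y c x.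
Proof.
move=> HR; split=> [[t [u [et /(HR (_, _, _))[w Tw]]]]|[x /andP[e t]]].
  by exists (enc ((t, u), w)); rewrite /meets encK et.
by exists (dec x : seq bool * nat * nat).1.1, (dec x : seq bool * nat * nat).1.2; split=> //; apply/(HR (_, _, _)); eexists; exact: t.
Qed.

Definition covers n r (X : nat -> bool) (Z : nat -> nat -> bool) :=
  all (fun x => X x ==> has (fun i => Z i x) (iota 0 r)) (iota 0 n).
Definition avoids n (e : seq cond) (Z : nat -> nat -> bool) :=
  all (fun i => all (fun x => ~~ meets (Z i) (nth ([::], 0) e i) x) (iota 0 n))
    (iota 0 (size e)).
(** A finite family of sets is stored by columns: entry [x] of [z] tells which of the sets contain
    [x]. *)
Definition strfam (z : seq (seq bool)) i x := nth false (nth [::] z x) i.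

Lemma coversP n r (X : nat -> bool) (Z : nat -> nat -> bool) : reflect (forall x, x < n -> X x -> exists2 i, i < r & Z i x)
  (covers n r X Z).
Proof.
apply: (iffP allP) => H x; last first.
  rewrite mem_iota add0n /= => lx; apply/implyP => /(H _ lx)[i li Zi].
  by apply/hasP; exists i; rewrite ?mem_iota.
move=> lx Xx; have := H x; rewrite mem_iota lx Xx => /(_ isT)/hasP[i].
by rewrite mem_iota => li Zi; exists i.
Qed.

Lemma avoidsP n e Z : reflect
  (forall i x, i < size e -> x < n -> ~~ meets (Z i) (nth ([::], 0) e i) x) (avoids n e Z).
Proof.
apply: (iffP allP) => H i.
  move=> x li lx; have := H i; rewrite mem_iota li => /(_ isT)/allP/(_ x).
  by rewrite mem_iota lx => /(_ isT).
by rewrite mem_iota add0n => /= li; apply/allP => x; rewrite mem_iota add0n => /= lx; apply: H.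
Qed.

Lemma covers_local n r X Z Z' : (forall i x, i < r -> x < n -> Z i x = Z' i x) ->
  covers n r X Z -> covers n r X Z'.
Proof.
by move=> e /coversP H; apply/coversP => x lx /(H x lx)[i li Zi]; exists i; rewrite // -e.
Qed.

Lemma avoids_local n e Z Z' : (forall i x, i < size e -> x < n -> Z i x = Z' i x) ->
  avoids n e Z -> avoids n e Z'.
Proof.
move=> h /avoidsP H; apply/avoidsP => i x li lx.
by rewrite -(@meets_local (Z i)) ?H // => y ly; apply: h => //; apply: ltn_trans lx.
Qed.

Lemma avoids_le m n e Z : m <= n -> avoids n e Z -> avoids m e Z.
Proof.
by move=> lmn /avoidsP H; apply/avoidsP => i x li lx; apply: H => //; apply: leq_trans lmn.
Qed.

Definition alive n e X := exists z, covers n (size e) X (strfam z) && avoids n e (strfam z).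

(* When some finite stage is dead, no cover avoids [e]; the constraints on [Z]
   then stop at the last stage that is alive. *)
Lemma avoiding_cover (X : nat -> bool) (e : seq cond) : 0 < size e ->
  exists Z, forall m, covers m (size e) X Z /\ (alive m e X -> avoids m e Z).
Proof.
(* All pieces of a cover are coded into one set [W], so that compactness applies. *)
move=> e0; pose fam (W : nat -> bool) i x := W (npair i x).
suff [W HW] : exists W, forall m, forall m', m' <= m ->
    covers m' (size e) X (fam W) /\ (alive m' e X -> avoids m' e (fam W)).
  by exists (fam W) => m; apply: (HW m).
apply: compactness => [m W H m' lm|m|m].
- by apply: H; apply: ltnW.
(* This bound exceeds [npair i x] for all [i < size e] and [x < m]. *)
- exists (2 ^ size e * m.*2.+1) => W W' h H m' lm; case: (H m' lm) => h1 h2.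
  have E i x : i < size e -> x < m' -> fam W i x = fam W' i x.
    move=> li lx; apply: h; rewrite npairS; apply: leq_mul.
      by rewrite leq_exp2l // ltnW.
    by rewrite ltnS leq_double ltnW // (leq_trans lx lm).
  by split; [exact: covers_local h1|move=> /h2; apply: avoids_local].
have ex : exists k, (k <= m) && asbool (alive k e X).
  exists 0; apply/asboolP; exists [::]; apply/andP; split; first by [].
  by apply/avoidsP.
have ub k : (k <= m) && asbool (alive k e X) -> k <= m by case/andP.
case: (ex_maxnP ex ub) => k /andP[km /asboolP[z /andP[cz az]]] kmax.
(* From [k] on, the last stage up to [m] that is alive, all pieces are full. This keeps them
   covering, as there is a piece 0. *)
pose W n := if nsnd n < k then strfam z (nfst n) (nsnd n) else true.
exists W => m' lm; split.
  apply/coversP => x lx Xx; rewrite /fam /W; case: (ltnP x k) => xk; last first.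
    by exists 0; rewrite // nsnd_pair ltnNge xk.
  have /coversP/(_ x xk Xx)[i li zi] := cz; exists i => //.
  by rewrite nsnd_pair nfst_pair xk.
move=> al; have m'k : m' <= k by apply: kmax; rewrite lm; apply/asboolP.
apply: avoids_local (avoids_le m'k az) => i x li lx.
by rewrite /fam /W nsnd_pair nfst_pair (leq_trans lx m'k).
Qed.

(** The restriction of an avoiding cover to numbers below [m] would witness that stage [m] is
    alive. *)
Lemma dead_cover m e X (Z : nat -> nat -> bool) : ~ alive m e X ->
  (forall x, X x -> exists2 i, i < size e & Z i x) ->
  exists i x, i < size e /\ meets (Z i) (nth ([::], 0) e i) x.
Proof.
move=> dead cov; apply: NNPP => H; apply: dead.
pose z := mkseq (fun x => mkseq (Z^~ x) (size e)) m.
have E i x : i < size e -> x < m -> Z i x = strfam z i x.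
  by move=> li lx; rewrite /strfam nth_mkseq // nth_mkseq.
exists z; apply/andP; split.
  by apply: (covers_local E); apply/coversP => x _; apply: cov.
apply: (avoids_local E); apply/avoidsP => i x li lx; apply/negP => h.
by apply: H; exists i, x.
Qed.

End Covering.

Lemma ucomp_meets {I} {O : I -> nat -> bool} {A} {eA : encodable A} T
    (Y : I -> A -> nat -> bool) (c : I -> A -> seq bool * nat) (x : I -> A -> nat) :
  ucomp O (fun _ p => T p.1 p.2) ->
  ucomp O (fun i p => Y i p.1 p.2) -> ucomp O c -> ucomp O x ->
  ucomp O (fun i a => meets T (Y i a) (c i a) (x i a)).
Proof.
move=> HT HY Hc Hx; rewrite /meets; cbv zeta; apply: ucomp_and.
  by apply: ucomp_ext_string; uc.
by uc.
Qed.

Ltac uc_meets :=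
  lazymatch goal with
  | |- ucomp _ (fun i a => meets _ (@?f i a) (@?g i a) (@?h i a)) => apply: ucomp_meets
  | |- ucomp _ (fun i a => ext (@?f i a) (@?g i a) (@?h i a)) => apply: ucomp_ext_string
  | |- _ => uc_hlt
  end.
Ltac uc_ext ::= uc_meets.

(** * The splitting tree over the old reservoirs and a low path through it *)

Section Step.

Variables (L : nat -> bool) (R : nat -> seq bool -> nat -> Prop).
Variables (Xp : nat -> nat -> bool) (Cp : cond -> bool).
Hypothesis R_ce : rce L (fun q : nat * seq bool * nat => R q.1.1 q.1.2 q.2).
Hypothesis Xp_comp : rcomp L (fun q : nat * nat => Xp q.1 q.2).
Hypothesis Cp_comp : rcomp (jump L) Cp.
Local Notation good := (fun Y => forall c, Cp c -> forces_on R c Y).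
Hypothesis large : ~ small good Xp xpredT.

(** The stage codes a tuple and a counter, so every nonempty tuple recurs infinitely often. The
    empty tuple is replaced because a cover needs at least one piece. *)
Definition tup (s : nat) : seq cond :=
  let e := (dec s : seq cond * nat).1 in if nilp e then [:: ([::], 0)] else e.

Lemma size_tup s : 0 < size (tup s).
Proof. by rewrite /tup; case: (dec s).1. Qed.

Lemma tup_often e t : 0 < size e -> exists2 s, t <= s & tup s = e.
Proof.
move=> e0; exists (enc (e, t)); first exact: leq_npair2.
by rewrite /tup encK; case: e e0.
Qed.

Lemma ucomp_tup {I} {O : I -> nat -> bool} {A} {eA : encodable A} (f : I -> A -> nat) :
  ucomp O f -> ucomp O (fun i a => tup (f i a)).
Proof. by move=> Hf; rewrite /tup; uc. Qed.

(** A node of the splitting tree lists the choices made so far, latest first. [Y] holds a family of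
    pieces for every node, and a branch intersects the chosen pieces with the old reservoirs. *)
Fixpoint branch (Y : nat -> bool) (b : seq nat) (x : nat) : bool :=
  if b is i :: b' then [&& branch Y b' x, Y (enc (b, x)) & Xp (size b) x] else Xp 0 x.

Lemma ucomp_branch {I} {O : I -> nat -> bool} {A} {eA : encodable A}
    (Y : I -> nat -> bool) (b : I -> A -> seq nat) (x : I -> A -> nat) :
  ucomp O Y -> ucomp O (fun _ q => Xp q.1 q.2) -> ucomp O b -> ucomp O x ->
  ucomp O (fun i a => branch (Y i) (b i a) (x i a)).
Proof.
move=> HY HX Hb Hx; apply: (@ucomp_ext _ _ _ _ _ _ (fun i a =>
  (foldr (fun k (acc : seq nat * bool) => (k :: acc.1,
     [&& acc.2, Y i (enc (k :: acc.1, x i a)) & Xp (size acc.1).+1 (x i a)]))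
   ([::], Xp 0 (x i a)) (b i a)).2)); last by uc.
move=> i a; set F := foldr _ _ _; suff -> : F = (b i a, branch (Y i) (b i a) (x i a)) by [].
by rewrite /F; elim: (b i a) => //= k l ->.
Qed.

Lemma branch_Xp Y b x : branch Y b x -> Xp (size b) x.
Proof. by case: b => [|i b] //= /and3P[]. Qed.

Definition piece (Y : nat -> bool) (b : seq nat) (i x : nat) := Y (enc (i :: b, x)).

Section FixT.
Variable T : nat * seq bool * nat -> nat -> bool.
Hypothesis T_comp : rcomp L (fun p => T p.1 p.2).
Hypothesis R_T : forall q : nat * seq bool * nat, R q.1.1 q.1.2 q.2 <-> exists w, T q w.

(** A query is a node, a stage and a candidate finite cover. Over all candidates it says that the
    pieces at the node avoid the tuple up to every stage that is alive. Only finite objects are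
    quantified, so the class is Pi_1(L). *)
Definition splits Y (q : seq nat * nat * seq (seq bool)) :=
  let b := q.1.1 in let m := q.1.2 in let e := tup (size b) in
  covers m (size e) (branch Y b) (piece Y b) &&
  ((covers m (size e) (branch Y b) (strfam q.2) && avoids T m e (strfam q.2)) ==>
   avoids T m e (piece Y b)).

Lemma splits_index : exists e0, forall Y, ~~ jump (join Y L) e0 <-> forall q, splits Y q.
Proof.
have : uce (join^~ L) (fun Y (_ : nat) => exists q, ~~ splits Y q).
  apply: uce_ex; first by uc.
  apply: ucomp_uce.
  have HX : ucomp (join^~ L) (fun _ q => Xp q.1 q.2) by apply: rcomp_lift Xp_comp; exact: ucomp_join_r.
  have HT : ucomp (join^~ L) (fun _ p => T p.1 p.2) by apply: rcomp_lift T_comp; exact: ucomp_join_r.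
  have HY : ucomp (join^~ L) (fun Y x => Y x) by apply: ucomp_join_l; uc.
  have Ht : ucomp (join^~ L) (fun _ s => tup s) by apply: ucomp_tup; uc.
  have Hb : ucomp (join^~ L) (fun Y q => branch Y q.1 q.2) by apply: ucomp_branch; uc.
  rewrite /splits /covers /avoids /piece /strfam.
  move: tup Ht => tp Ht; move: branch Hb => br Hb; by uc.
move=> /uce_jump[f _ Hf]; exists (f (enc 0)) => Y; rewrite -[jump _ _]negbK; split.
  by rewrite !negbK => h q; apply: contraNT h => h; apply/(Hf Y 0); exists q.
by move=> h; rewrite negbK; apply/negP => /(Hf Y 0)[q]; rewrite h.
Qed.

(** At each node choose a cover given by [avoiding_cover]. The recursion along nodes is there
    because the set to be covered depends on the earlier choices. *)
Lemma splits_nonempty : exists Y, forall q, splits Y q.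
Proof.
pose isP (q : (nat -> bool) * nat) Z := forall m,
  covers m (size (tup q.2)) q.1 Z /\ (alive T m (tup q.2) q.1 -> avoids T m (tup q.2) Z).
pose G q := epsilon (inhabits (fun _ _ => true)) (isP q).
have HG q : isP q (G q).
  by apply: (epsilon_spec _ (isP q)); apply: avoiding_cover; apply: size_tup.
pose XG := fix XG b : nat -> bool := if b is i :: b' then
  fun x => [&& XG b' x, G (XG b', size b') i x & Xp (size b) x] else Xp 0.
pose (Y := fun n => if (dec n : seq nat * nat).1 is i :: b then
   G (XG b, size b) i (dec n : seq nat * nat).2 else true).
have YE b i x : piece Y b i x = G (XG b, size b) i x by rewrite /piece /Y encK.
have XE b x : branch Y b x = XG b x.
  by elim: b => // i b IH; rewrite [LHS]/= IH -[Y _]/(piece Y b i x) YE.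
exists Y => -[[b m] z]; rewrite /splits /=; have [h1 h2] := HG (XG b, size b) m.
have cE Z : covers m (size (tup (size b))) (branch Y b) Z =
            covers m (size (tup (size b))) (XG b) Z.
  by apply: eq_all => x; rewrite XE.
rewrite !cE; apply/andP; split.
  by apply: covers_local h1 => i x _ _; rewrite YE.
apply/implyP => h; apply: (@avoids_local _ _ _ (G (XG b, size b))).
  by move=> i x _ _; rewrite YE.
by apply: h2; exists z.
Qed.

Section FixY.
Variable Y : nat -> bool.
Hypothesis Y_low : Tle (jump (join Y L)) (jump L).
Hypothesis Y_splits : forall q, splits Y q.

Lemma branch_cover b x : branch Y b x ->
  exists2 i, i < size (tup (size b)) & piece Y b i x.
Proof.
have /andP[/coversP H _] := Y_splits (b, x.+1, [::]).
exact: H.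
Qed.

(** If all stages are alive, the chosen pieces avoid the tuple at every stage; if one is dead, no
    cover whatsoever avoids it. *)
Lemma branch_decides b (e := tup (size b)) :
  (forall i, i < size e -> ~ forces_on R (nth ([::], 0) e i) (branch Y (i :: b))) \/
  (forall Z : nat -> nat -> bool,
     (forall x, branch Y b x -> exists2 i, i < size e & Z i x) ->
     exists2 i, i < size e & forces_on R (nth ([::], 0) e i) (Z i)).
Proof.
have [al|/not_all_ex_not[m dead]] := classic (forall m, alive T m e (branch Y b)).
  left=> i li /(forces_on_meets _ _ R_T)[x hx].
  have [z hz] := al x.+1; have /andP[_ /implyP/(_ hz)/avoidsP H] := Y_splits (b, x.+1, z).
  case/negP: (H i x li (ltnSn x)); apply: meets_sub hx => y /= /and3P[_ h _].
  exact: h.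
right=> Z cov; have [i [x [li hx]]] := dead_cover dead cov; exists i => //.
by apply/(forces_on_meets _ _ R_T); exists x.
Qed.

Let inb (q : seq nat * cond) := asbool (forces_on R q.2 (branch Y q.1)).

Lemma join_low : rcomp (jump L) (join Y L).
Proof. by apply/Tle_rcomp; apply: Tle_trans Y_low; apply: Tle_jump. Qed.

(** Satisfying a requirement is enumerable in [join Y L], hence decided by its jump, which is below
    [jump L] by the lowness of [Y]. *)
Lemma inb_comp : rcomp (jump L) inb.
Proof.
apply: (rcomp_lift (X := jump (join Y L))); first exact/Tle_rcomp.
apply: rce_rcomp_jump.
apply: (@uce_ext _ _ _ _ (fun _ q => exists x, meets T (branch Y q.1) q.2 x)).
  by move=> _ q; rewrite (forces_on_meets _ _ R_T).
apply: uce_ex; first by uc.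
apply: ucomp_uce.
have HL : rcomp (join Y L) L by apply/Tle_rcomp; apply: Tle_join_r.
have HX : rcomp (join Y L) (fun q => Xp q.1 q.2) by apply: rcomp_lift Xp_comp.
have HT : rcomp (join Y L) (fun p => T p.1 p.2) by apply: rcomp_lift T_comp.
have HY : rcomp (join Y L) Y by apply/Tle_rcomp; apply: Tle_join_l.
have Hb : rcomp (join Y L) (fun q => branch Y q.1 q.2) by apply: ucomp_branch; uc.
by move: (branch Y) Hb => br Hb; uc.
Qed.

(** [D] is a set of nodes that contains the root and a child of each of its members, and whose
    branches meet the inherited requirements. Children are bounded in number, and [jump L] decides
    [Cp] and [inb], so this is a Pi_1 class relative to [jump L]. *)
Definition selects (D : nat -> bool) (q : seq nat * cond) :=
  [&& D (enc ([::] : seq nat)),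
    D (enc q.1) ==> has (fun i => D (enc (i :: q.1))) (iota 0 (size (tup (size q.1)))) &
    (D (enc q.1) && Cp q.2) ==> inb q].

Lemma selects_index : exists e0, forall D,
  ~~ jump (join D (jump L)) e0 <-> forall q, selects D q.
Proof.
have : uce (join^~ (jump L)) (fun D (_ : nat) => exists q, ~~ selects D q).
  apply: uce_ex; first by uc.
  apply: ucomp_uce.
  have HC : ucomp (join^~ (jump L)) (fun _ => Cp) by apply: rcomp_lift Cp_comp; exact: ucomp_join_r.
  have Hi : ucomp (join^~ (jump L)) (fun _ => inb) by apply: rcomp_lift inb_comp; exact: ucomp_join_r.
  have HD : ucomp (join^~ (jump L)) (fun D x => D x) by apply: ucomp_join_l; uc.
  have Ht : ucomp (join^~ (jump L)) (fun _ s => tup s) by apply: ucomp_tup; uc.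
  rewrite /selects; move: tup Ht => tp Ht; move: (inb) Hi => ib Hi; by uc.
move=> /uce_jump[f _ Hf]; exists (f (enc 0)) => D; rewrite -[jump _ _]negbK; split.
  by rewrite !negbK => h q; apply: contraNT h => h; apply/(Hf D 0); exists q.
by move=> h; rewrite negbK; apply/negP => /(Hf D 0)[q]; rewrite h.
Qed.

(** The nodes with large branches qualify: if all children were small their union would be, and a
    branch failing an inherited requirement is small. *)
Lemma selects_nonempty : exists D, forall q, selects D q.
Proof.
exists (fun n => asbool (~ small good Xp (branch Y (dec n)))) => -[b c].
rewrite /selects !encK; apply/and3P; split.
- apply/asboolP => h; apply: large; apply: (small_union h (@small_tail _ _ (fun x => ~~ Xp 0 x) 0 _)).
    by [].
  by move=> n _ /=; case: (Xp 0 n).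
- apply/implyP => /asboolP h; apply: contraT => /hasPn H; exfalso; apply: h.
  apply: (@small_union _ _ (fun x => branch Y b x && Xp (size b).+1 x)
    (fun x => branch Y b x && ~~ Xp (size b).+1 x)); last first.
  + by move=> n ->; case: (Xp _ n).
  + by apply: (@small_tail _ _ _ (size b).+1) => x /andP[].
  + apply: (@small_bigunion _ _ (size (tup (size b))) (fun i => branch Y (i :: b))).
      move=> i li; apply: NNPP => h; have := H i; rewrite mem_iota li encK => /(_ isT).
      by case/asboolP.
    move=> n /andP[bn xn]; have [i li pi] := branch_cover bn; exists i => //=.
    by rewrite bn xn -[Y _]/(piece Y b i n) pi.
- apply/implyP => /andP[/asboolP h Cc]; apply/asboolP; apply: NNPP => h'.
  by apply: h; apply: small_bad => /(_ c Cc).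
Qed.

End FixY.
End FixT.

(** The low basis theorem gives the covers [Y] over [L] and then the selected nodes [D] over
    [jump L]; the new oracle is [join D (jump L)]. The new reservoirs are the branches along the
    path that takes the least child in [D]. *)
Lemma step_lemma : exists (Lp : nat -> bool) (X : nat -> nat -> bool),
  [/\ Tle (jump L) Lp /\ Tle (jump Lp) (jump (jump L)),
      rcomp Lp (fun q => X q.1 q.2) /\
      rcomp Lp (fun q : nat * cond => asbool (forces_on R q.2 (X q.1))),
      (forall s x, X s x -> Xp s x) /\ (forall s x, X s.+1 x -> X s x),
      forall c s, Cp c -> forces_on R c (X s) &
      forall e t, 0 < size e -> exists2 s, t <= s &
        (exists2 i, i < size e & ~ forces_on R (nth ([::], 0) e i) (X s.+1)) \/
        (forall Z : nat -> nat -> bool,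
          (forall x, X s x -> exists2 i, i < size e & Z i x) ->
          exists2 i, i < size e & forces_on R (nth ([::], 0) e i) (Z i))].
Proof.
have [T0 HT0 ET0] := R_ce.
pose T := T0 tt; have T_comp : rcomp L (fun p => T p.1 p.2).
  by apply: ucomp_ext HT0 => -[].
have R_T q : R q.1.1 q.1.2 q.2 <-> exists w, T q w by exact: ET0.
have [e0 He0] := splits_index T_comp.
have [|Y /He0 HY Ylow] := @low_basis L e0.
  by have [Y HY] := splits_nonempty T; exists Y; apply/He0.
have [e1 He1] := selects_index T_comp R_T Ylow.
have [|D /He1 HD Dlow] := @low_basis (jump L) e1.
  by have [D HD] := selects_nonempty HY; exists D; apply/He1.
pose (nxt := fun b : seq nat =>
  find (fun i => D (enc (i :: b))) (iota 0 (size (tup (size b)))) :: b).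
pose bt s := iter s nxt [::].
have size_bt s : size (bt s) = s by elim: s => //= s ->.
have D0 : D (enc ([::] : seq nat)) by have /and3P[] := HD ([::], ([::], 0)).
have Dbt s : D (enc (bt s)) /\ head 0 (bt s.+1) < size (tup s).
  have Dn b : D (enc b) -> D (enc (nxt b)) /\ head 0 (nxt b) < size (tup (size b)).
    move=> Db; have /and3P[_ /implyP/(_ Db) h _] := HD (b, ([::], 0)).
    have := nth_find 0 h; rewrite /nxt; move: h; rewrite has_find size_iota => h.
    by rewrite nth_iota.
  have Ds : D (enc (bt s)) by elim: s => // s /Dn[].
  by split=> //; have [_] := Dn _ Ds; rewrite size_bt.
exists (join D (jump L)), (fun s => branch Y (bt s)).
have HJ : rcomp (join D (jump L)) (jump L) by apply/Tle_rcomp; apply: Tle_join_r.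
have Ht : rcomp (join D (jump L)) tup by apply: ucomp_tup; uc.
have Hbt : rcomp (join D (jump L)) bt.
  have HDD : rcomp (join D (jump L)) D by apply/Tle_rcomp; apply: Tle_join_l.
  by rewrite /bt /nxt; move: tup Ht => tp Ht; uc.
have HL : rcomp (join D (jump L)) (join Y L).
  by apply: rcomp_lift (join_low Ylow).
have HX : rcomp (join D (jump L)) (fun q => Xp q.1 q.2).
  apply: rcomp_lift HL (rcomp_lift _ Xp_comp).
  by apply/Tle_rcomp; apply: Tle_join_r.
have HYY : rcomp (join D (jump L)) Y.
  by apply: rcomp_lift HL _; apply/Tle_rcomp; apply: Tle_join_l.
split.
- by split=> //; apply/Tle_rcomp.
- split; first by apply: ucomp_branch => //; uc.
  have Hi := rcomp_lift HJ (inb_comp T_comp R_T Ylow).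
  apply: (@ucomp_comp _ _ _ _ _ _ _ _ (fun _ q => asbool (forces_on R q.2 (branch Y q.1)))
    (fun _ (q : nat * cond) => (bt q.1, q.2)) Hi).
  by uc.
- split; first by move=> s x /branch_Xp; rewrite size_bt.
  by move=> s x /= /and3P[].
- move=> c s Cc; have /and3P[_ _ /implyP] := HD (bt s, c).
  by rewrite (Dbt s).1 Cc => /(_ isT)/asboolP.
(* The tuple [e] is treated at some stage [s >= t], and [branch_decides] at the node of the path
   reached there yields the two alternatives. *)
- move=> e t e0'; have [s ts es] := tup_often t e0'; exists s => //.
  have := branch_decides R_T HY (bt s); rewrite size_bt es => -[H|H]; last by right.
  left; exists (head 0 (bt s.+1)); first by have [_] := Dbt s; rewrite es.
  by apply: H; have [_] := Dbt s; rewrite es.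
Qed.

End Step.

(** * Levels of iterated jump control *)

(** What the truth lemmas use of a construction of [G] from stems [sg s] and reservoirs [Y s]. The
    clock [t s] is at once an index of an old reservoir and an enumeration stage. The last field
    says that every requirement gets settled. *)
Record run (R : nat -> seq bool -> nat -> Prop) (Xp : nat -> nat -> bool) (Cp : cond -> bool)
    (sg : nat -> seq bool) (Y : nat -> nat -> bool) (t : nat -> nat) (G : nat -> bool) : Prop := {
  run_ext : forall s, ext (Y s) (sg s) (sg s.+1);
  run_dec : forall s x, Y s.+1 x -> Y s x;
  run_time : forall s, t s <= t s.+1;
  run_size : forall s, s <= size (sg s);
  run_Xp : forall s x, Y s x -> Xp (t s) x;
  run_Cp : forall s c, Cp c -> forces_on R c (Y s);
  run_G : forall s x, x < size (sg s) -> nth false (sg s) x = G x;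
  run_complete : forall j, exists s, R j (sg s) (t s) \/ ~ forces_on R (sg s, j) (Y s) }.

Section RunTheory.
Variables (R : nat -> seq bool -> nat -> Prop) (Xp : nat -> nat -> bool) (Cp : cond -> bool).
Variables (sg : nat -> seq bool) (Y : nat -> nat -> bool) (t : nat -> nat) (G : nat -> bool).
Hypothesis H : run R Xp Cp sg Y t G.

Lemma run_dec_le s s' x : s <= s' -> Y s' x -> Y s x.
Proof.
elim: s' => [|s' IH]; first by rewrite leqn0 => /eqP ->.
by rewrite leq_eqVlt => /predU1P[-> //|/IH h /(run_dec H)].
Qed.

Lemma run_ext_le s s' : s <= s' -> ext (Y s) (sg s) (sg s').
Proof.
elim: s' => [|s' IH]; first by rewrite leqn0 => /eqP ->; apply: ext_refl.
rewrite leq_eqVlt => /predU1P[->|le]; first exact: ext_refl.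
apply: ext_trans (IH le) (ext_sub _ (run_ext H s')) => x; exact: run_dec_le.
Qed.

Lemma run_time_le s s' : s <= s' -> t s <= t s'.
Proof.
elim: s' => [|s' IH]; first by rewrite leqn0 => /eqP ->.
by rewrite leq_eqVlt => /predU1P[-> //|/IH h]; apply: leq_trans h (run_time H s').
Qed.

Lemma run_string s : sg s = mkseq G (size (sg s)).
Proof.
apply: (@eq_from_nth _ false); first by rewrite size_mkseq.
by move=> x lx; rewrite nth_mkseq // (run_G H).
Qed.

Lemma run_refute_le s s' j : s <= s' ->
  ~ forces_on R (sg s, j) (Y s) -> ~ forces_on R (sg s', j) (Y s').
Proof.
move=> le nf [u [v [eu Ru]]]; apply: nf; exists u, v; split=> //.
apply: ext_trans (run_ext_le le) (ext_sub _ eu) => x; exact: run_dec_le.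
Qed.

End RunTheory.

(** Forcing agrees with truth along every run: positive decisions persist and are correct, negative
    ones are correct. *)
Definition truth R Xp Cp (K : (nat -> bool) -> nat -> bool) :=
  forall sg Y t G, run R Xp Cp sg Y t G -> forall s j,
  [/\ R j (sg s) (t s) -> forall s', s <= s' -> R j (sg s') (t s'),
      R j (sg s) (t s) -> K G j &
      ~ forces_on R (sg s, j) (Y s) -> ~~ K G j].

(** The induction invariant. [level_large] lets the next step find a path, [level_empty] keeps
    reservoirs nonempty, and [level_infinite] places the infinitude of [G] among the inherited
    requirements. *)
Record level (k : nat) (L : nat -> bool) (R : nat -> seq bool -> nat -> Prop)
    (Xp : nat -> nat -> bool) (Cp : cond -> bool) (K : (nat -> bool) -> nat -> bool) : Prop := {
  level_ce : rce L (fun q : nat * seq bool * nat => R q.1.1 q.1.2 q.2);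
  level_mono : forall j s u u', u <= u' -> R j s u -> R j s u';
  level_Xp_comp : rcomp L (fun q : nat * nat => Xp q.1 q.2);
  level_Cp_comp : rcomp (jump L) Cp;
  level_large : ~ small (fun Y => forall c, Cp c -> forces_on R c Y) Xp xpredT;
  level_empty : exists2 c, Cp c & ~ forces_on R c xpred0;
  level_truth : truth R Xp Cp K;
  level_infinite : forall m, exists2 q, forall s, Cp (s, q) &
    forall G, K G q <-> exists x, m <= x /\ G x;
  level_jump : forall G, Tle (jumpn k.+1 G) (K G);
  level_above : Tle (jumpn k emptyset) L;
  level_low : Tle (jump L) (jumpn k.+1 emptyset) }.

Lemma level0 : exists L R Xp Cp K, level 0 L R Xp Cp K.
Proof.
have [f Hf Ef] : exists2 f : nat -> nat,
    (forall J (O : J -> nat -> bool), ucomp O (fun _ => f)) &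
    forall (G : nat -> bool) m, (exists x, m <= x /\ G x) <-> jump G (f m).
  apply: (@uce_jump _ (fun G : nat -> bool => G) nat _ (fun (G : nat -> bool) m => exists x, m <= x /\ G x)).
  apply: (@uce_ext _ _ _ _ (fun (G : nat -> bool) m => exists x, (m <= x) && G x)).
    by move=> G m; split=> -[x]; [case/andP=> h h'; exists x|case=> h h'; exists x; rewrite h].
  apply: uce_ex; first by uc.
  by apply: ucomp_uce; uc.
pose R := fun j s (_ : nat) => hlt s j : Prop.
pose Cp := fun c : cond => asbool (exists m, c.2 = f m).
(* At level 0 the reservoirs are all of omega, forcing is halting on the stem, and the inherited
   requirements say that [G] is infinite. *)
exists emptyset, R, (fun _ _ => true), Cp, jump.
have good_inf (z : nat -> bool) : (forall m, exists x, m <= x /\ z x) ->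
    forall c, Cp c -> forces_on R c z.
  move=> inf [s j] /asboolP[m /= ->].
  have [x [lx zx]] := inf (maxn m (size s)); rewrite geq_max in lx; case/andP: lx => mx sx.
  (* Adding to the stem one element [x >= m] of [z] that lies past its end puts [f m] into the jump,
     and a long enough prefix shows this. *)
  pose G y := nth false s y || (y == x).
  have /jump_hlt[r Hr] : jump G (f m) by apply/Ef; exists x; rewrite /G eqxx orbT.
  have pre : prefix s (mkseq G (maxn r (size s))).
    have -> : s = mkseq G (size s).
      apply: (@eq_from_nth _ false); first by rewrite size_mkseq.
      move=> y ly; rewrite nth_mkseq // /G; case: eqP ly => [->|_ _]; last by rewrite orbF.
      by rewrite ltnNge sx.
    by rewrite size_mkseq; apply: prefix_mkseq; apply: leq_maxr.
  exists (mkseq G (maxn r (size s))), 0; split.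
    apply/extP; split=> // y /andP[sy]; rewrite size_mkseq => ly.
    by rewrite nth_mkseq // /G nth_default // => /eqP ->.
  by apply: hlt_mono Hr; apply: prefix_mkseq; apply: leq_maxl.
split.
- by apply: (@ucomp_uce _ _ _ _ (fun _ q => hlt q.1.2 q.1.1)); uc.
- by [].
- by uc.
- apply: rce_rcomp_jump; apply: uce_ex; first by uc.
  apply: (@uce_ext _ _ _ _ (fun _ p => p.1.2 == f p.2)).
    by move=> _ p; split=> /eqP.
  by apply: ucomp_uce; have := Hf unit (fun=> emptyset) => {}Hf; uc.
(* Infinite sets are good, so small sets are bounded. *)
- have fin (z : nat -> bool) : small (fun Y => forall c, Cp c -> forces_on R c Y) (fun _ _ => true) z ->
      exists n, forall x, z x -> x < n.
    elim=> {z} [z nz|z s h|x y z _ [n Hn] _ [m Hm] h].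
    + apply: NNPP => inf; apply: nz; apply: good_inf => m; apply: NNPP => H.
      by apply: inf; exists m => x zx; rewrite ltnNge; apply/negP => mx; apply: H; exists x.
    + by exists 0 => x /h.
    + by exists (maxn n m) => k /h/orP[/Hn|/Hm]; rewrite leq_max => ->; rewrite ?orbT.
  by move=> /fin[n /(_ n isT)]; rewrite ltnn.
- exists ([::], f 0); first by apply/asboolP; exists 0.
  (* An extension of the empty stem inside the empty set has only zeros, whereas [f 0] asks for an
     element. *)
  case=> u [v [/extP[_ eu] Ru]].
  have : jump xpred0 (f 0).
    apply/jump_hlt; exists (size u); rewrite -[mkseq _ _](_ : u = _) //.
    apply: (@eq_from_nth _ false); first by rewrite size_mkseq.
    by move=> x lx; rewrite nth_mkseq //; apply/negP => /(eu x); rewrite lx => /(_ isT).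
  by move/Ef => [x []].
- move=> sg Y t G H s j; split.
  + by move=> h s' le; apply: hlt_mono h; case/extP: (run_ext_le H le).
  + by move=> h; apply/jump_hlt; exists (size (sg s)); rewrite -(run_string H).
  + move=> nf; apply/negP => /jump_hlt[m Hm]; apply: nf.
    exists (sg (maxn s m)), 0; split; first by apply: (run_ext_le H); apply: leq_maxl.
    apply: hlt_mono Hm; rewrite (run_string H); apply: prefix_mkseq.
    exact: leq_trans (leq_maxr s m) (run_size H _).
- move=> m; exists (f m); first by move=> s; apply/asboolP; exists m.
  by move=> G; rewrite Ef.
- by move=> G; apply: Tle_refl.
- exact: Tle_refl.
- exact: Tle_refl.
Qed.

(** * From one level to the next *)

Section Successor.
Variables (k : nat) (L : nat -> bool) (R : nat -> seq bool -> nat -> Prop).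
Variables (Xp : nat -> nat -> bool) (Cp : cond -> bool) (K : (nat -> bool) -> nat -> bool).
Hypothesis HL : level k L R Xp Cp K.
Variables (Lp : nat -> bool) (X : nat -> nat -> bool).
Hypothesis L_Lp : Tle (jump L) Lp.
Hypothesis X_comp : rcomp Lp (fun q => X q.1 q.2).
Hypothesis X_decides : rcomp Lp (fun q : nat * cond => asbool (forces_on R q.2 (X q.1))).
Hypothesis X_Xp : forall s x, X s x -> Xp s x.
Hypothesis X_dec : forall s x, X s.+1 x -> X s x.
Hypothesis X_Cp : forall c s, Cp c -> forces_on R c (X s).
Hypothesis X_large : forall e t, 0 < size e -> exists2 s, t <= s &
  (exists2 i, i < size e & ~ forces_on R (nth ([::], 0) e i) (X s.+1)) \/
  (forall Z : nat -> nat -> bool,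
    (forall x, X s x -> exists2 i, i < size e & Z i x) ->
    exists2 i, i < size e & forces_on R (nth ([::], 0) e i) (Z i)).

Lemma X_dec_le s s' x : s <= s' -> X s' x -> X s x.
Proof.
elim: s' => [|s' IH]; first by rewrite leqn0 => /eqP ->.
by rewrite leq_eqVlt => /predU1P[-> //|/IH h /X_dec].
Qed.

Lemma X_nonempty s : exists x, X s x.
Proof.
have [c Cc nc] := level_empty HL; apply: NNPP => H; apply: nc.
apply: forces_on_sub (X_Cp s Cc) => x Xx; case: H; by exists x.
Qed.

(* Odd codes repeat the previous level; the even code [2 j] asks for
   [j] to enter the jump of the set decided at the previous level. *)
Definition Rsucc j s u :=
  if odd j then R j./2 s u else
  exists w, hlt w j./2 /\ forall i, i < size w ->
    if nth false w i then R i s u else ~ forces_on R (s, i) (X u).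

(** Only repeated requirements are inherited, and among them those that no reservoir loses. This is
    Pi_1 in the new oracle, hence decided by its jump. *)
Definition Csucc (c : cond) := odd c.2 && asbool (forall s, forces_on R (c.1, c.2./2) (X s)).

Definition Ksucc G := join (jump (K G)) (K G).

Lemma L_comp : rcomp Lp L.
Proof. by apply/Tle_rcomp; apply: Tle_trans L_Lp; apply: Tle_jump. Qed.

Lemma Rsucc_odd j s u : Rsucc j.*2.+1 s u = R j s u.
Proof. by rewrite /Rsucc /= odd_double /= uphalf_double. Qed.

Lemma forces_on_odd s j Y : forces_on Rsucc (s, j.*2.+1) Y <-> forces_on R (s, j) Y.
Proof.
by split=> -[u [v [e Ru]]]; exists u, v; split=> //; move: Ru; rewrite /= Rsucc_odd.
Qed.

(** [Lp] decides the refutations in the even clause, and the quantifier over [i] is bounded, so only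
    existential search remains. *)
Lemma Rsucc_ce : rce Lp (fun q : nat * seq bool * nat => Rsucc q.1.1 q.1.2 q.2).
Proof.
have HR := rce_lift L_comp (level_ce HL).
apply: (@uce_ext _ _ _ _ (fun _ q => (odd q.1.1 /\ R q.1.1./2 q.1.2 q.2) \/
  (~~ odd q.1.1 /\ exists w, hlt w q.1.1./2 /\ forall i, i < size w ->
    (nth false w i /\ R i q.1.2 q.2) \/
    (~~ nth false w i && ~~ asbool (forces_on R (q.1.2, i) (X q.2)))))).
  move=> _ [[j s] u]; rewrite /Rsucc /=; case: (odd j).
    by split=> [[[]|[]]|h] //; left.
  split=> [[[]|[_ [w [hw H]]]]|[w [hw H]]] //; [|right; split=> //]; exists w; split=> // i /H.
    by case: (nth false w i) => -[[]|] // /asboolP.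
  by case: (nth false w i) => h; [left|right; apply/asboolP].
apply: uce_or.
  apply: uce_and; first by apply: ucomp_uce; uc.
  by apply: (uce_comp (f := fun _ q => (q.1.1./2, q.1.2, q.2)) HR); uc.
apply: uce_and; first by apply: ucomp_uce; uc.
apply: uce_ex; first by uc.
apply: uce_and; first by apply: ucomp_uce; uc.
apply: uce_forall_lt; last by uc.
apply: uce_or.
  apply: uce_and; first by apply: ucomp_uce; uc.
  by apply: (uce_comp (f := fun _ (q : nat * seq bool * nat * seq bool * nat) =>
    (q.2, q.1.1.1.2, q.1.1.2)) HR); uc.
apply: ucomp_uce; apply: ucomp_and; first by uc.
apply: ucomp_neg.
apply: (ucomp_comp (f := fun _ (q : nat * seq bool * nat * seq bool * nat) =>
  (q.1.1.2, (q.1.1.1.2, q.2))) X_decides); uc.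
Qed.

Lemma Csucc_comp : rcomp (jump Lp) Csucc.
Proof.
have HN : rcomp (jump Lp) (fun c : cond =>
    asbool (exists s, ~~ asbool (forces_on R (c.1, c.2./2) (X s)))).
  apply: rce_rcomp_jump; apply: uce_ex; first by uc.
  apply: ucomp_uce; apply: ucomp_neg.
  by apply: (ucomp_comp (f := fun _ (q : cond * nat) => (q.2, (q.1.1, q.1.2./2))) X_decides); uc.
apply: (@ucomp_ext _ _ _ _ _ _ (fun _ c => odd c.2 &&
  ~~ asbool (exists s, ~~ asbool (forces_on R (c.1, c.2./2) (X s))))).
  move=> _ c; congr (_ && _); apply/negP/asboolP => [H s|H /asboolP[s /asboolP]] //.
  by apply/asboolP; apply: contraT => h; case: H; apply/asboolP; exists s.
by apply: ucomp_and; [uc|apply: ucomp_neg].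
Qed.

(** A small set is covered, inside some reservoir, by finitely many sets each failing a requirement
    that all reservoirs meet. For the tuple of these requirements both outcomes of [X_large] are
    contradictory. *)
Lemma succ_large : ~ small (fun Y => forall c, Csucc c -> forces_on Rsucc c Y) X xpredT.
Proof.
have key z : small (fun Y => forall c, Csucc c -> forces_on Rsucc c Y) X z ->
  exists e (Z : nat -> nat -> bool) s,
    (forall i, i < size e -> (forall s', forces_on R (nth ([::], 0) e i) (X s')) /\
      ~ forces_on R (nth ([::], 0) e i) (Z i)) /\
    forall x, z x -> X s x -> exists2 i, i < size e & Z i x.
  elim=> {z} [z nz|z s h|x y z _ [e1 [Z1 [s1 [H1 c1]]]] _ [e2 [Z2 [s2 [H2 c2]]]] h].
  - have [c /(imply_to_and (Csucc c))[Cc nc]] := not_all_ex_not _ _ nz.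
    case: c Cc nc => s j /andP[/= oj /asboolP Cj].
    rewrite -(odd_double_half j) oj add1n forces_on_odd => nc.
    exists [:: (s, j./2)], (fun=> z), 0; split=> [[|i] //|x zx _]; by exists 0.
  - by exists [::], (fun=> z), s; split=> // x /h/negP.
  exists (e1 ++ e2), (fun i => if i < size e1 then Z1 i else Z2 (i - size e1)), (maxn s1 s2).
  rewrite size_cat; split=> [i li|n zn Xn].
    rewrite nth_cat; case: ltnP => l1; first exact: H1.
    by apply: H2; lia.
  case/orP: (h n zn) => [xn|yn].
    have [i li Zi] := c1 n xn (X_dec_le (leq_maxl s1 s2) Xn).
    by exists i; rewrite ?li // ltn_addr.
  have [i li Zi] := c2 n yn (X_dec_le (leq_maxr s1 s2) Xn).
  exists (size e1 + i); first by rewrite ltn_add2l.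
  by rewrite ltnNge leq_addr addKn.
(* With an empty tuple the reservoir itself would be empty. *)
case/key=> e [Z [s [H cov]]]; case: (posnP (size e)) => [e0|e0].
  by have [x Xx] := X_nonempty s; have [] := cov x isT Xx => i; rewrite e0.
have [s' le [[i li nf]|/(_ Z)]] := X_large s e0; first by case: nf; apply: (H i li).1.
case=> [x Xx|i li fi]; first exact: cov isT (X_dec_le le Xx).
exact: (H i li).2.
Qed.

Lemma succ_truth : truth Rsucc X Csucc Ksucc.
Proof.
move=> sg Y t G H.
(* A run of the new level is a run of the old one, so the old truth lemma applies to each bit of
   [K G]. *)
have H0 : run R Xp Cp sg Y t G.
  split; try by case: H.
  - by move=> s x /(run_Xp H)/X_Xp.
  - move=> s [c j] Cc; apply/forces_on_odd; apply: (run_Cp H).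
    rewrite /Csucc /= odd_double /= uphalf_double; apply/asboolP => s'; exact: X_Cp.
  - move=> j; have [s Hs] := run_complete H j.*2.+1; exists s.
    by move: Hs; rewrite forces_on_odd Rsucc_odd.
have T := level_truth HL H0.
(* An extension of the later stem inside the later reservoir also extends the earlier stem inside
   the earlier reservoir. *)
have keep s s' i : s <= s' -> ~ forces_on R (sg s, i) (X (t s)) ->
    ~ forces_on R (sg s', i) (X (t s')).
  move=> le nf [u [v [eu Ru]]]; apply: nf; exists u, v; split=> //.
  apply: ext_trans (ext_sub _ (run_ext_le H le)) (ext_sub _ eu) => x.
    exact: (run_Xp H).
  exact: X_dec_le (run_time_le H le).
move=> s j; rewrite -(odd_double_half j); case: (odd j); last first.
  rewrite add0n /Ksucc join_even /Rsucc odd_double doubleK; split.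
  - move=> [w [hw Hw]] s' le; exists w; split=> // i /Hw; case: (nth false w i).
      by move=> Ri; have [stay _ _] := T s i; apply: stay.
    exact: keep.
  - move=> [w [hw Hw]]; apply/jump_hlt; exists (size w); suff <- : w = mkseq (K G) (size w) by [].
    apply: (@eq_from_nth _ false); first by rewrite size_mkseq.
    move=> i li; rewrite nth_mkseq //; have := Hw i li; have [_ pos neg] := T s i.
    case: (nth false w i) => [/pos -> //|nf]; apply/esym/negbTE/neg.
    by move=> fi; apply: nf; apply: forces_on_sub fi => x; apply: (run_Xp H).
  (* Suppose [m] bits of [K G] put [j] into its jump. Some later stem settles these bits, and some
     later stage [u] has a reservoir [X u] confirming the negative ones. At stage [u] that stem
     forces [j], against the refutation. *)
  - move=> nf; apply/negP => /jump_hlt[m Hm]; apply: nf.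
    have [s' le Hs'] : exists2 s', s <= s' & forall i, i < m ->
        if K G i then R i (sg s') (t s') else ~ forces_on R (sg s', i) (Y s').
      elim: m {Hm} => [|m [s' le IH]]; first by exists s.
      have [s1 Hs1] := run_complete H0 m; exists (maxn s' s1).
        exact: leq_trans le (leq_maxl _ _).
      move=> i; rewrite ltnS leq_eqVlt => /predU1P[->|/IH].
        have [_ pos neg] := T s1 m; case: Hs1 => h.
          have [stay _ _] := T s1 m; rewrite (pos h); exact: stay (leq_maxr _ _).
        by rewrite (negbTE (neg h)); apply: (run_refute_le H0) h; apply: leq_maxr.
      case: (K G i) => h; last by apply: (run_refute_le H0) h; apply: leq_maxl.
      by have [stay _ _] := T s' i; apply: stay => //; apply: leq_maxl.
    have [u lu Hu] : exists2 u, t s' <= u & forall i, i < m ->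
        if K G i then R i (sg s') u else ~ forces_on R (sg s', i) (X u).
      elim: m Hs' {Hm} => [|m IH] Hs'; first by exists (t s').
      have [|u lu Hu] := IH; first by move=> i li; apply: Hs'; apply: ltnW.
      have [u' Hu'] : exists u', if K G m then R m (sg s') u' else
          ~ forces_on R (sg s', m) (X u').
        have := Hs' m (ltnSn m); case: (K G m) => [h|nf]; first by exists (t s').
        (* If no [X v] refuted this requirement, it would be inherited and hence met by [Y s'],
           contrary to the negative decision. *)
        apply: NNPP => h; apply: nf; apply/forces_on_odd; apply: (run_Cp H).
        rewrite /Csucc /= odd_double /= uphalf_double; apply/asboolP => v.
        by apply: NNPP => h'; apply: h; exists v.
      have mono i v v' : v <= v' ->
          (if K G i then R i (sg s') v else ~ forces_on R (sg s', i) (X v)) ->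
          if K G i then R i (sg s') v' else ~ forces_on R (sg s', i) (X v').
        move=> lv; case: (K G i); first exact: (level_mono HL).
        by move=> h h'; apply: h; apply: forces_on_sub h' => x; apply: X_dec_le.
      exists (maxn u u'); first exact: leq_trans lu (leq_maxl _ _).
      move=> i; rewrite ltnS leq_eqVlt => /predU1P[->|/Hu].
        by apply: mono Hu'; apply: leq_maxr.
      by apply: mono; apply: leq_maxl.
    exists (sg s'), u; split; first exact: (run_ext_le H).
    rewrite /Rsucc /= odd_double doubleK; exists (mkseq (K G) m); split=> // i.
    by rewrite size_mkseq => li; rewrite nth_mkseq //; apply: Hu.
rewrite add1n /Ksucc join_odd Rsucc_odd; have [stay pos neg] := T s j./2; split=> //.
  by move=> h s' le; rewrite Rsucc_odd; apply: stay.
by rewrite forces_on_odd.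
Qed.

Lemma level_succ : Tle (jump Lp) (jump (jump L)) -> level k.+1 Lp Rsucc X Csucc Ksucc.
Proof.
move=> Lp_low; split.
- exact: Rsucc_ce.
- move=> j s u u' le; rewrite /Rsucc; case: (odd j); first exact: (level_mono HL).
  move=> [w [hw Hw]]; exists w; split=> // i /Hw; case: (nth _ _ _); first exact: (level_mono HL).
  by move=> h h'; apply: h; apply: forces_on_sub h' => x; apply: X_dec_le.
- exact: X_comp.
- exact: Csucc_comp.
- exact: succ_large.
- have [[s j] Cc nc] := level_empty HL; exists (s, j.*2.+1); last by rewrite forces_on_odd.
  by rewrite /Csucc /= odd_double /= uphalf_double; apply/asboolP => s'; apply: X_Cp.
- exact: succ_truth.
- move=> m; have [q Cq Hq] := level_infinite HL m; exists q.*2.+1.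
    by move=> s; rewrite /Csucc /= odd_double /= uphalf_double; apply/asboolP => s'; apply: X_Cp.
  by move=> G; rewrite /Ksucc join_odd.
- move=> G; apply: Tle_trans (Tle_join_l _ _); exact: jump_mono (level_jump HL G).
- apply: Tle_trans L_Lp; exact: jump_mono (level_above HL).
- apply: Tle_trans Lp_low _; exact: jump_mono (level_low HL).
Qed.

End Successor.

Lemma level_exists k : exists L R Xp Cp K, level k L R Xp Cp K.
Proof.
elim: k => [|k [L [R [Xp [Cp [K HL]]]]]]; first exact: level0.
have [Lp [X [[l1 l2] [c1 c2] [s1 s2] hC hD]]] := step_lemma (level_ce HL)
  (level_Xp_comp HL) (level_Cp_comp HL) (level_large HL).
by do 5!eexists; apply: (level_succ HL) l2; eassumption.
Qed.

(** * The final construction *)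

Section Construction.
Variables (k : nat) (L : nat -> bool) (R : nat -> seq bool -> nat -> Prop).
Variables (Xp : nat -> nat -> bool) (Cp : cond -> bool) (K : (nat -> bool) -> nat -> bool).
Hypothesis HL : level k L R Xp Cp K.
Variables (Lp : nat -> bool) (X : nat -> nat -> bool).
Hypothesis L_Lp : Tle (jump L) Lp.
Hypothesis X_comp : rcomp Lp (fun q => X q.1 q.2).
Hypothesis X_decides : rcomp Lp (fun q : nat * cond => asbool (forces_on R q.2 (X q.1))).
Hypothesis X_Xp : forall s x, X s x -> Xp s x.
Hypothesis X_dec : forall s x, X s.+1 x -> X s x.
Hypothesis X_Cp : forall c s, Cp c -> forces_on R c (X s).
Hypothesis X_large : forall e t, 0 < size e -> exists2 s, t <= s &
  (exists2 i, i < size e & ~ forces_on R (nth ([::], 0) e i) (X s.+1)) \/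
  (forall Z : nat -> nat -> bool,
    (forall x, X s x -> exists2 i, i < size e & Z i x) ->
    exists2 i, i < size e & forces_on R (nth ([::], 0) e i) (Z i)).
Variable A : nat -> bool.
Hypothesis A_comp : rcomp Lp A.

Definition side (b : bool) {B} (p : B * B) := if b then p.1 else p.2.

Local Notation gstate := (seq bool * seq bool * nat)%type.
Local Notation witness := (bool * bool * seq bool * nat * nat)%type.

(** The extra zero adds no element but lengthens the stem at every stage, as [run_size] demands. *)
Definition padded (q : gstate) b := rcons (side b q.1) false.

(* A witness (pos, b, t, u, w) settles the requirement of side [b], positively
   by the string [t] and the enumeration stage [w], or negatively; in both
   cases the reservoir becomes [X u]. *)
Definition settles (T : nat * seq bool * nat -> nat -> bool)
    (q : gstate) (j : nat * nat) (w : witness) :=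
  let pos := w.1.1.1.1 in let b := w.1.1.1.2 in let t := w.1.1.2 in let u := w.1.2 in
  (q.2 <= u) &&
  (if pos then ext (fun x => X q.2 x && (A x == b)) (padded q b) t && T (side b j, t, u) w.2
   else ~~ asbool (forces_on R (padded q b, side b j) (X u))).

Definition advance (q : gstate) (w : witness) : gstate :=
  let sg b := if w.1.1.1.1 && (w.1.1.1.2 == b) then w.1.1.2 else padded q b in
  (sg true, sg false, w.1.2).

(** For the pair of requirements, [X_large] gives a later reservoir refuting one of them, or else
    the cover of a reservoir by [A] and its complement satisfies one of them inside the matching
    part. *)
Lemma settles_exists (T : nat * seq bool * nat -> nat -> bool) q j :
  (forall q : nat * seq bool * nat, R q.1.1 q.1.2 q.2 <-> exists w, T q w) ->
  exists w, settles T q j w.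
Proof.
move=> R_T.
have [s le Hs] := @X_large [:: (padded q true, j.1); (padded q false, j.2)] q.2 isT.
case: Hs => [[i li nf]|/(_ (fun i x => X s x && (A x == (i == 0))))].
  exists (false, i == 0, [::], s.+1, 0); rewrite /settles /= (leqW le) /=.
  by apply/asboolP; case: i li nf => [|[|]].
case=> [x Xx|i li [t [u [et Rt]]]].
  case Ax : (A x); [exists 0|exists 1] => //=; by rewrite Xx.
(* The enumeration stage is raised to at least [q.2], since it also becomes the next reservoir
   index, which must not decrease. *)
have Rt' : R (side (i == 0) j) t (maxn q.2 u).
  apply: (level_mono HL (leq_maxr q.2 u)).
  by case: i li Rt {et} => [|[|]].
have [w Tw] := (R_T (_, _, _)).1 Rt'.
exists (true, i == 0, t, maxn q.2 u, w); rewrite /settles /= leq_maxl Tw andbT /=.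
have -> : padded q (i == 0) =
    (nth ([::], 0) [:: (padded q true, j.1); (padded q false, j.2)] i).1.
  by case: i li {et Rt Rt' Tw} => [|[|]].
by apply: ext_sub et => x /andP[/(X_dec_le X_dec le) -> ->].
Qed.

Lemma construction : exists2 G : nat -> bool,
  infinite_set G /\ ((forall x, G x -> A x) \/ (forall x, G x -> ~~ A x)) & Tle (K G) Lp.
Proof.
have R_ce := rce_lift (L_comp L_Lp) (level_ce HL).
have [T0 HT0 ET0] := R_ce.
pose T := T0 tt; have T_comp : rcomp Lp (fun p => T p.1 p.2).
  by apply: ucomp_ext HT0 => -[].
have R_T q : R q.1.1 q.1.2 q.2 <-> exists w, T q w by exact: ET0.
(* [Lp] decides whether a witness settles a pair, so witnesses can be found by search. *)
have [|||F HF EF] := @ucomp_search _ (fun _ : unit => Lp) (gstate * (nat * nat)) _ witness _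
  (fun _ a w => settles T a.1 a.2 w).
- by uc.
- rewrite /settles /padded /side; cbv beta zeta; apply: ucomp_and; first by uc.
  apply: ucomp_if; first by uc.
    by uc.
  apply: ucomp_neg.
  apply: (ucomp_comp (f := fun _ (p : gstate * (nat * nat) * witness) =>
     (p.2.1.2, (rcons (if p.2.1.1.1.2 then p.1.1.1.1 else p.1.1.1.2) false,
       if p.2.1.1.1.2 then p.1.2.1 else p.1.2.2))) X_decides).
  by uc.
- by move=> _ a; apply: settles_exists.
(* Stage [s] treats the pair of requirements that [s] codes. *)
pose (st := fun r : nat * gstate => (r.1.+1, advance r.2 (F tt (r.2, (dec r.1 : nat * nat))))).
pose Q s : gstate := (iter s st (0, ([::], [::], 0))).2.
have Q1 s : (iter s st (0, ([::], [::], 0))).1 = s by elim: s => //= s ->.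
pose (W := fun s => F tt (Q s, (dec s : nat * nat))).
have QS s : Q s.+1 = advance (Q s) (W s) by rewrite /Q iterS {1}/st Q1.
have HW s : settles T (Q s) (dec s) (W s) by exact: (EF tt (Q s, dec s)).
have Q_comp : rcomp Lp Q.
  have HF' : rcomp Lp (F tt) by apply: ucomp_ext HF => -[].
  rewrite /Q /st /advance /padded /side; move: (F tt) HF' => f Hf; by uc.
pose sg b s := side b (Q s).1.
have time s : (Q s).2 <= (Q s.+1).2 by rewrite QS; have /andP[] := HW s.
have sg_ext b s : ext (fun x => X (Q s).2 x && (A x == b)) (sg b s) (sg b s.+1).
  have pad : ext (fun x => X (Q s).2 x && (A x == b)) (sg b s) (padded (Q s) b).
    apply/extP; split; first by rewrite /padded -cats1 prefix_prefix.
    move=> x; rewrite /padded size_rcons ltnS => /andP[h1 h2].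
    have -> : x = size (sg b s) by apply/eqP; rewrite eqn_leq h1 h2.
    by rewrite nth_rcons ltnn eqxx.
  apply: ext_trans pad _; rewrite /sg QS /advance.
  have := HW s; rewrite /settles; case: (W s) => [[[[pos b'] t] u] w] /= /andP[_].
  case: pos => [/andP[h _]|_]; last by case: (b); apply: ext_refl.
  by case: b' h => h; case: (b) => //=; apply: ext_refl.
have sg_size b s : s <= size (sg b s).
  elim: s => // s IH; apply: leq_ltn_trans IH _.
  rewrite {2}/sg QS /advance; have := HW s; rewrite /settles.
  case: (W s) => [[[[pos b'] t] u] w] /= /andP[_].
  have pd c : size (sg c s) < size (padded (Q s) c) by rewrite /padded size_rcons.
  case: pos => [/andP[/extP[/size_prefix h _] _]|_]; last by case: (b); apply: pd.
  by case: b' h => h; case: (b) => //=; try exact: pd; apply: leq_trans h; apply: pd.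
pose G b x := nth false (sg b x.+1) x.
have sg_prefix b s s' : s <= s' -> prefix (sg b s) (sg b s').
  elim: s' => [|s' IH]; first by rewrite leqn0 => /eqP ->; apply: prefix_refl.
  rewrite leq_eqVlt => /predU1P[->|/IH h]; first exact: prefix_refl.
  by apply: prefix_trans h _; case/extP: (sg_ext b s').
have sg_G b s x : x < size (sg b s) -> nth false (sg b s) x = G b x.
  move=> lx; rewrite /G; case: (leqP s x.+1) => le.
    by case/prefixP: (sg_prefix b _ _ le) => r ->; rewrite nth_cat lx.
  by case/prefixP: (sg_prefix b _ _ (ltnW le)) => r ->; rewrite nth_cat sg_size.
have G_side b x : G b x -> A x == b.
  rewrite /G; elim: x.+1 => [|s IH]; first by rewrite nth_default // /sg /side; case: (b).
  have /extP[/prefixP[r e] H] := sg_ext b s.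
  case: (ltnP x (size (sg b s))) => lx; first by rewrite e nth_cat lx.
  case: (ltnP x (size (sg b s.+1))) => lx'; last by rewrite nth_default.
  by move=> h; have := H x; rewrite lx lx' h => /(_ isT isT)/andP[].
(* If each side left some requirement unsettled forever, the stage treating these two would settle
   one of them. *)
have [b comp] : exists b, forall j, exists s,
    R j (sg b s) (Q s).2 \/ ~ forces_on R (sg b s, j) (X (Q s).2).
  apply: NNPP => H.
  have {}H b : exists j, forall s,
      ~ (R j (sg b s) (Q s).2 \/ ~ forces_on R (sg b s, j) (X (Q s).2)).
    have [j Hj] := not_all_ex_not _ _ (not_ex_all_not _ _ H b).
    by exists j => s h; apply: Hj; exists s.
  have [j1 H1] := H true; have [j0 H0] := H false.
  have [s es] : exists s, dec s = (j1, j0) by exists (npair j1 j0); exact: (encK (j1, j0)).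
  have := HW s; have n1 := H1 s.+1; have n0 := H0 s.+1.
  rewrite /settles es; rewrite /sg QS in n0 n1.
  case: (W s) n0 n1 => [[[[pos b'] t] u] w]; rewrite /advance /= => n0 n1 /andP[_].
  case: pos n0 n1 => /= n0 n1; last by case: b' => /= /asboolP h; [apply: n1|apply: n0]; right.
  case/andP=> _ Tw; have Rt : R (side b' (j1, j0)) t u by apply/(R_T (_, _, _)); exists w.
  by case: b' n0 n1 Tw Rt => /= n0 n1 _ Rt; [apply: n1|apply: n0]; left.
have HR : run R Xp Cp (sg b) (fun s => X (Q s).2) (fun s => (Q s).2) (G b).
  split=> //.
  - by move=> s; apply: ext_sub (sg_ext b s) => x /andP[].
  - by move=> s x; apply: (X_dec_le X_dec).
  - by move=> s x; apply: X_Xp.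
  - by move=> s c; apply: X_Cp.
  - exact: sg_G.
have truthG := level_truth HL HR.
(* As every requirement is settled on side [b], both [K (G b)] and its complement are enumerable in
   [Lp]. *)
have K_pos j : K (G b) j <-> exists s, R j (sg b s) (Q s).2.
  split=> [Kj|[s Rs]]; last by have [_ pos _] := truthG s j; apply: pos.
  have [s [Rs|nf]] := comp j; first by exists s.
  by have [_ _ neg] := truthG s j; move: (neg nf); rewrite Kj.
have K_neg j : ~~ K (G b) j <-> exists s, ~~ asbool (forces_on R (sg b s, j) (X (Q s).2)).
  split=> [Kj|[s /asboolP nf]]; last by have [_ _ neg] := truthG s j; apply: neg.
  have [s [Rs|nf]] := comp j; last by exists s; apply/asboolP.
  by have [_ pos _] := truthG s j; move: Kj; rewrite (pos Rs).
exists (G b); first split.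
(* The requirement that [G] has an element [>= m] is met by every reservoir, so it can only be
   settled positively. *)
- move=> m; have [q Cq Hq] := level_infinite HL m; apply/Hq/K_pos.
  by have [s [Rs|nf]] := comp q; [exists s|case: nf; apply: (run_Cp HR)].
- case: (b) G_side => G_side; [left|right] => x /G_side; first by move/eqP ->.
  by move/eqP ->.
apply/Tle_rcomp.
have sg_comp : rcomp Lp (sg b).
  by rewrite /sg /side; case: (b); uc.
apply: rcomp_post.
  apply: (@uce_ext _ _ _ _ (fun _ j => exists s, R j (sg b s) (Q s).2)).
    by move=> _ j; rewrite K_pos.
  apply: uce_ex; first by uc.
  by apply: (uce_comp (f := fun _ (p : nat * nat) => (p.1, sg b p.2, (Q p.2).2)) R_ce); uc.
apply: (@uce_ext _ _ _ _ (fun _ j => exists s, ~~ asbool (forces_on R (sg b s, j) (X (Q s).2)))).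
  by move=> _ j; rewrite K_neg.
apply: uce_ex; first by uc.
apply: ucomp_uce; apply: ucomp_neg.
by apply: (ucomp_comp (f := fun _ (p : nat * nat) => ((Q p.2).2, (sg b p.2, p.1))) X_decides); uc.
Qed.

End Construction.

Theorem theorem3 (n : nat) (A : nat -> bool) :
  computable_in (jumpn n.+1 emptyset) A ->
  exists H : nat -> bool,
    infinite_set H /\
    ((forall x, H x -> A x) \/ (forall x, H x -> ~~ A x)) /\
    Tle (jumpn n.+2 H) (jumpn n.+2 emptyset).
Proof.
move=> HA; have [L [R [Xp [Cp [K HL]]]]] := level_exists n.
have [Lp [X [[l1 l2] [c1 c2] [s1 s2] hC hD]]] := step_lemma (level_ce HL)
  (level_Xp_comp HL) (level_Cp_comp HL) (level_large HL).
(* [A] is computable in the jump of [jumpn n emptyset], and [L] computes the latter, so [jump L] and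
   with it [Lp] compute [A]. *)
have ALp : rcomp Lp A.
  apply/Tle_rcomp; apply: Tle_trans HA (Tle_trans _ l1).
  exact: jump_mono (level_above HL).
have [G [Ginf Gside] KG] := construction HL l1 c1 c2 s1 s2 hC hD ALp.
exists G; split=> //; split=> //.
(* [jumpn n.+2 G] is below [jump Lp], hence below [jump (jump L)], hence below [jumpn n.+2 emptyset]
   by the lowness of [L]. *)
apply: Tle_trans (jump_mono (Tle_trans (level_jump HL G) KG)) _.
exact: Tle_trans l2 (jump_mono (level_low HL)).
Qed.
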